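(* Every homogeneous locally conical connected separable metric space that is not a $1$-manifold is strongly $n$-homogeneous for each $n \geq 2$. Furthermore, every homogeneous locally conical separable metric space (not necessarily connected, and possibly a $1$-manifold) is countable dense homogeneous.
   Context: The open cone over a compact space $Y$ is the quotient space $Y \times (0,\infty]/Y \times \{\infty\}$. A space is locally conical if every point of the space has an open neighborhood that is homeomorphic to the open cone over a compact space (the point is not required to correspond to the cone vertex). A space $X$ is homogeneous if for any two points $p$ and $q$ of $X$ there is a homeomorphism of $X$ onto itself that maps $p$ to $q$. For $n \geq 1$, a space $X$ is strongly $n$-homogeneous if every bijection between two $n$-element subsets of $X$ can be extended to a homeomorphism of $X$ onto itself. A space $X$ is countable dense homogeneous if for any two countable dense subsets $A$ and $B$ of $X$ there is a homeomorphism of $X$ onto itself that maps $A$ onto $B$. *)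

(* Defs.v *)
From HB Require Import structures.
From mathcomp Require Import all_boot all_order all_algebra.
From mathcomp Require Import all_classical all_reals all_analysis.

Set Implicit Arguments.
Unset Strict Implicit.
Unset Printing Implicit Defensive.

Import Order.TTheory GRing.Theory Num.Theory.
Import numFieldNormedType.Exports.

Local Open Scope classical_set_scope.
Local Open Scope card_scope.
Local Open Scope ring_scope.

Definition homeomorphism (X Y : topologicalType) (f : X -> Y) : Prop :=
  continuous f /\
  exists g : Y -> X, [/\ cancel f g, cancel g f & continuous g].

Definition homeomorphic (X Y : topologicalType) : Prop :=
  exists f : X -> Y, homeomorphism f.

Section OpenCone.
Variables (R : realType) (Y : topologicalType).

(* The half-open interval (0, +oo], with the topology induced by \bar R. *)
Definition half_open : set (\bar R) := [set t | (0 < t)%E].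

Definition cone_cylinder := (Y * set_type half_open)%type.

Definition cone_rel (a b : cone_cylinder) : bool :=
  (a == b) || (set_val a.2 == +oo%E) && (set_val b.2 == +oo%E).

Lemma cone_rel_refl : reflexive cone_rel.
Proof. by move=> a; rewrite /cone_rel eqxx. Qed.

Lemma cone_rel_sym : symmetric cone_rel.
Proof. by move=> a b; rewrite /cone_rel eq_sym andbC. Qed.

Lemma cone_rel_trans : transitive cone_rel.
Proof.
move=> b a c; rewrite /cone_rel => /orP[/eqP->//|/andP[a1 b1]].
by move=> /orP[/eqP<-|/andP[_ c1]]; rewrite a1 ?b1 ?c1 orbT.
Qed.

Canonical cone_equiv :=
  EquivRel cone_rel cone_rel_refl cone_rel_sym cone_rel_trans.

(* For empty Y the cone is empty, so it is never a neighborhood of a point. *)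
Definition open_cone : topologicalType :=
  quotient_topology {eq_quot cone_equiv}%qT.

End OpenCone.

Definition locally_conical (R : realType) (X : topologicalType) : Prop :=
  forall x : X, exists U : set X, [/\ open U, U x &
    exists Y : topologicalType,
      compact [set: Y] /\ homeomorphic (set_type U) (open_cone R Y)].

Definition homogeneous (X : topologicalType) : Prop :=
  forall p q : X, exists h : X -> X, homeomorphism h /\ h p = q.

(* A bijection between subsets is given by a total function, of which only the
   values on the first subset matter. *)
Definition strongly_homogeneous (n : nat) (X : topologicalType) : Prop :=
  forall (A B : set X) (f : X -> X),
    A #= `I_n -> B #= `I_n -> set_bij A B f ->
    exists h : X -> X, homeomorphism h /\ forall x, A x -> h x = f x.

Definition countable_dense_homogeneous (X : topologicalType) : Prop :=
  forall A B : set X,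
    countable A -> dense A -> countable B -> dense B ->
    exists h : X -> X, homeomorphism h /\ h @` A = B.

Definition separable_space (X : topologicalType) : Prop :=
  exists D : set X, countable D /\ dense D.

Definition one_manifold (R : realType) (X : topologicalType) : Prop :=
  [/\ hausdorff_space X, @second_countable X &
    forall x : X, exists U : set X,
      [/\ open U, U x & homeomorphic (set_type U) R]].

(* Main.v *)
Require Import Defs.
From HB Require Import structures.
From mathcomp Require Import all_boot all_order all_algebra.
From mathcomp Require Import all_classical all_reals all_analysis.
From mathcomp Require Import lra ring.
Import numFieldNormedType.Exports.
Local Open Scope classical_set_scope.
Set Implicit Arguments.
Unset Strict Implicit.
Unset Printing Implicit Defensive.
Import Order.TTheory GRing.Theory Num.Theory.
Local Open Scope ring_scope.

(** Everything rests on the relation [moves N x y]: some self-homeomorphism of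
the space that fixes every point outside [N] carries [x] to [y].  The heart of
the proof is [moves_open]: in a homogeneous locally conical separable metric
space the classes of [moves N] inside an open set [N] are open.  Both
conclusions follow from this.

Local mobility is obtained in three stages.

- A swindle ([chart_swindle]).  Let [p] and [q] be apexes of two cones whose
  sublevel balls interleave, in the order [p], [q], [p], [q].  The regions
  between consecutive spheres behave like mutually inverse cobordisms, so the
  punctured balls around [p] and around [q] are two bracketings of one infinite
  composition, and they are homeomorphic relative to the outer sphere.
  Concretely, three radial homeomorphisms are composed to a [g] which equals the
  identity outside a ball [K] and intertwines a contraction of [K] to [p] with a
  contraction of [K] to [q]; iterating [g] pushes [p] to [q] ([swindle]).

- A count and a Baire argument ([moves_almost_open]).  The interleaving holds as
  soon as the two cones have the same finite unions of basic open sets between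
  their successive balls, and there are only countably many such codes.  Hence
  [N] is covered by countably many sets of mutually equivalent points; a point
  that is exceptional for no basic [N] exists by Baire's theorem, and by
  homogeneity every point [x] is interior to the closure of its class.

- Successive approximation ([moves_nbhs]).  If [y] is near [x], then [x] can be
  moved close to [y], then [y] closer to the image of [x], and so on, inside
  supports shrinking to a point.  The two infinite compositions converge to
  homeomorphisms, and these send [x] and [y] to the same point.

For a connected open [N] the open classes of [moves N] reduce to one, so strong
homogeneity of every finite order follows when complements of finite sets are
connected: points are corrected one at a time.  If the base [Y] of the cones is
connected, a small punctured cone is connected and removing a point does not
disconnect ([connected_punctured]).  If [Y] is disconnected, a point on a ray of
a cone is itself the apex of a disconnected punctured cone, which by the product
structure is possible only if the ray is open ([isolated_link_point]); then the
space is locally a line, hence a one-manifold.  Countable dense homogeneity is a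
back-and-forth construction: homeomorphisms with small supports match the two
countable sets point by point.  A metric of a locally compact space need not be
complete, so the supports are also kept small compared with the radius of local
compactness ([lcr]). *)

(** * Self-homeomorphisms and their limits *)

Section Automorphisms.
Variable T : topologicalType.

(** The inverse is kept as data, so that composites, iterates and limits are
taken on both sides at once. *)
Record auto := Auto {
  fw :> T -> T;
  bw : T -> T;
  fwK : cancel fw bw;
  bwK : cancel bw fw;
  fw_cont : continuous fw;
  bw_cont : continuous bw }.

Lemma auto_homeomorphism (f : auto) : homeomorphism f.
Proof.
by split; [exact: fw_cont|exists (bw f); split; [exact: fwK|exact: bwK|exact: bw_cont]].
Qed.

Lemma homeomorphism_auto (f : T -> T) :
  homeomorphism f -> exists g : auto, forall x, g x = f x.
Proof. by move=> [cf [g [fK gK cg]]]; exists (Auto fK gK cf cg). Qed.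

Definition auto_id : auto :=
  @Auto id id (fun=> erefl) (fun=> erefl) (fun x => cvg_id) (fun x => cvg_id).

Definition auto_inv (f : auto) : auto :=
  Auto (@bwK f) (@fwK f) (@bw_cont f) (@fw_cont f).

Definition auto_comp (f g : auto) : auto :=
  Auto (can_comp (@fwK f) (@fwK g)) (can_comp (@bwK g) (@bwK f))
    (fun x => continuous_comp (@fw_cont g x) (@fw_cont f (g x)))
    (fun x => continuous_comp (@bw_cont f x) (@bw_cont g (bw f x))).

Lemma iter_cancel (f g : T -> T) n : cancel f g -> cancel (iter n f) (iter n g).
Proof. by move=> fK; elim: n => // n IH x; rewrite iterSr iterS fK IH. Qed.

Lemma iter_continuous (f : T -> T) n : continuous f -> continuous (iter n f).
Proof.
move=> cf; elim: n => [|n IH] x; first exact: cvg_id.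
exact: continuous_comp (IH x) (cf _).
Qed.

Definition auto_iter (f : auto) (n : nat) : auto :=
  Auto (iter_cancel n (@fwK f)) (iter_cancel n (@bwK f))
    (@iter_continuous _ n (@fw_cont f)) (@iter_continuous _ n (@bw_cont f)).

Lemma fw_inj (f : auto) : injective f.
Proof. exact: can_inj (@fwK f). Qed.

Definition supported (f : T -> T) (N : set T) := forall x, ~ N x -> f x = x.

Lemma supported_bw (f : auto) N : supported f N -> supported (bw f) N.
Proof. by move=> fN x /fN fx; rewrite -{1}fx fwK. Qed.

Lemma supported_stable (f : auto) N x : supported f N -> N x -> N (f x).
Proof.
move=> fN Nx; apply: contrapT => Nfx.
by apply: (Nfx); rewrite (fw_inj (fN _ Nfx)).
Qed.

Definition moves (N : set T) (x y : T) :=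
  exists f : auto, supported f N /\ f x = y.

Lemma moves_refl N x : moves N x x.
Proof. by exists auto_id; split. Qed.

Lemma moves_sym N x y : moves N x y -> moves N y x.
Proof.
by move=> [f [fN <-]]; exists (auto_inv f); split; [exact: supported_bw|exact: fwK].
Qed.

Lemma moves_trans N x y z : moves N x y -> moves N y z -> moves N x z.
Proof.
move=> [f [fN <-]] [g [gN <-]]; exists (auto_comp g f); split => // w Nw.
by rewrite /= fN// gN.
Qed.

Lemma movesS N M x y : N `<=` M -> moves N x y -> moves M x y.
Proof.
by move=> NM [f [fN fx]]; exists f; split => // w Mw; apply: fN => /NM.
Qed.

Lemma moves_stable N x y : moves N x y -> N x -> N y.
Proof. by move=> [f [fN <-]]; exact: supported_stable. Qed.

Lemma moves_conj (h : auto) N x y :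
  moves N x y -> moves (bw h @^-1` N) (h x) (h y).
Proof.
move=> [f [fN <-]]; exists (auto_comp h (auto_comp f (auto_inv h))); split.
  by move=> w Nw /=; rewrite fN// bwK.
by rewrite /= fwK.
Qed.

Lemma open_preimage_auto (f : auto) (U : set T) : open U -> open (f @^-1` U).
Proof. by move=> oU; move/continuousP: (@fw_cont f); apply. Qed.

End Automorphisms.

Section Limits.
Variables (R : realType) (X : metricType R).
Local Notation dist := (@mdist R X).

Lemma metric_nbhsP (x : X) (P : set X) :
  nbhs x P <-> exists2 e : R, 0 < e & forall y, dist x y < e -> P y.
Proof.
rewrite -metricType_numDomainType.filter_from_mdist_nbhs.
by split => -[e e0 H]; exists e => // y; exact: H.
Qed.

Lemma open_mball (x : X) (e : R) : open [set y | dist x y < e].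
Proof.
rewrite openE => y /= xy; apply/metric_nbhsP; exists (e - dist x y); first by lra.
by move=> z yz /=; have := metric_triangle x y z; lra.
Qed.

Lemma metric_cvgP (u : nat -> X) (l : X) : u @ \oo --> l <->
  forall e : R, 0 < e -> exists N, forall n, (N <= n)%N -> dist (u n) l < e.
Proof.
split.
  move=> ul e e0.
  have /metricType_numDomainType.cvgrPdist_lt/(_ e e0) := ul.
  by move=> [N _ H]; exists N => n Nn; rewrite metric_sym; exact: H.
move=> H; apply/metricType_numDomainType.cvgrPdist_lt => e /H[N NH].
by exists N => // n /= Nn; rewrite metric_sym; exact: NH.
Qed.

Lemma metric_continuousP (f : X -> X) : (continuous f) <->
  forall x (e : R), 0 < e -> exists2 d : R, 0 < d &
    forall y, dist x y < d -> dist (f x) (f y) < e.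
Proof.
split => [cf x e e0|H x A /metric_nbhsP[e e0 eA]].
  have /metric_nbhsP[d d0 dH] : nbhs x (f @^-1` [set z | dist (f x) z < e]).
    by apply: cf; apply/metric_nbhsP; exists e.
  by exists d.
have [d d0 dH] := H x e e0; apply/metric_nbhsP; exists d => // y /dH; exact: eA.
Qed.

Lemma metric_lim_unique (u : nat -> X) (l m : X) :
  u @ \oo --> l -> u @ \oo --> m -> l = m.
Proof. by apply: (cvg_unique); exact: metric_hausdorff. Qed.

Lemma cvg_eventually (u : nat -> X) (l : X) N :
  (forall n, (N <= n)%N -> u n = l) -> u @ \oo --> l.
Proof.
by move=> H; apply/metric_cvgP => e e0; exists N => n /H ->; rewrite mdistxx.
Qed.

Definition uniformly_cauchy (u : nat -> X -> X) :=
  forall e : R, 0 < e -> exists N, forall n, (N <= n)%N ->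
    forall x, dist (u N x) (u n x) < e.

Lemma uniformly_cauchy_limit u (f : X -> X) : uniformly_cauchy u ->
  (forall x, u n x @[n --> \oo] --> f x) -> (forall n, continuous (u n)) ->
  (forall e : R, 0 < e -> exists N, forall n, (N <= n)%N ->
     forall x, dist (u n x) (f x) < e) /\ continuous f.
Proof.
move=> cu uf ctu.
have U e : 0 < e -> exists N, forall n, (N <= n)%N ->
    forall x, dist (u n x) (f x) < e.
  move=> e0; have [N NH] := cu (e / 3) ltac:(lra).
  exists N => n Nn x.
  have [M MH] := (metric_cvgP _ _).1 (uf x) (e / 3) ltac:(lra).
  have d1 := NH _ Nn x; have d2 := NH _ (leq_maxl N M) x.
  have d3 := MH _ (leq_maxr N M).
  have := metric_triangle (u n x) (u N x) (f x).
  have := metric_triangle (u N x) (u (maxn N M) x) (f x).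
  rewrite (metric_sym (u n x) (u N x)); lra.
split => //; apply/metric_continuousP => x e e0.
have [N NH] := U (e / 3) ltac:(lra).
have [d d0 dH] := (metric_continuousP _).1 (ctu N) x (e / 3) ltac:(lra).
exists d => // y /dH xy.
have d1 := NH _ (leqnn N) x; have d2 := NH _ (leqnn N) y.
have := metric_triangle (f x) (u N x) (f y).
have := metric_triangle (u N x) (u N y) (f y).
rewrite (metric_sym (f x) (u N x)); lra.
Qed.

(** Passing to the limit in [u n (v n y) = y] needs uniform convergence on one
side only. *)
Lemma limit_cancel (u v : nat -> X -> X) (f g : X -> X) :
  (forall n, cancel (v n) (u n)) -> continuous f ->
  (forall e : R, 0 < e -> exists N, forall n, (N <= n)%N ->
     forall x, dist (u n x) (f x) < e) ->
  (forall x, v n x @[n --> \oo] --> g x) -> cancel g f.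
Proof.
move=> vu cf uf vg y.
apply/esym/mdist_positivity/eqP; rewrite eq_le mdist_ge0 andbT.
apply/ler_addgt0Pl => e e0; rewrite addr0.
have [d d0 dH] := (metric_continuousP _).1 cf (g y) (e / 2) ltac:(lra).
have [N NH] := uf (e / 2) ltac:(lra).
have [M MH] := (metric_cvgP _ _).1 (vg y) d d0.
have := NH _ (leq_maxl N M) (v (maxn N M) y); rewrite vu => d1.
have := MH _ (leq_maxr N M); rewrite metric_sym => /dH d2.
have := metric_triangle y (f (v (maxn N M) y)) (f (g y)).
rewrite (metric_sym (f (v _ _)) (f (g y))); lra.
Qed.

Lemma limit_auto (h : nat -> auto X) :
  uniformly_cauchy h -> uniformly_cauchy (fun n => bw (h n)) ->
  (forall x, exists l : X, h n x @[n --> \oo] --> l) ->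
  (forall x, exists l : X, bw (h n) x @[n --> \oo] --> l) ->
  exists f : auto X, forall x, h n x @[n --> \oo] --> f x.
Proof.
move=> ch cb /choice[f hf] /choice[g bg].
have [Uf cf] := uniformly_cauchy_limit ch hf (fun n => @fw_cont _ (h n)).
have [Ug cg] := uniformly_cauchy_limit cb bg (fun n => @bw_cont _ (h n)).
have gf : cancel g f by apply: limit_cancel cf Uf bg => n; exact: bwK.
have fg : cancel f g by apply: limit_cancel cg Ug hf => n; exact: fwK.
by exists (Auto fg gf cf cg).
Qed.

Definition shrinking (Q : nat -> set X) := forall e : R, 0 < e ->
  exists n, forall a b, Q n a -> Q n b -> dist a b < e.

(** The [n]-th change takes place inside [Q n], whose preimage also shrinks.
Hence away from one point the sequence [h] is eventually constant, and the tails
of [h] and of its inverses differ only within the small sets [Q n] and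
[h n @^-1` Q n].  The points [p] and [z] are where these sets accumulate. *)
Lemma nested_limit (h : nat -> auto X) (Q : nat -> set X) (p z : X) :
  (forall n, Q n.+1 `<=` Q n) ->
  (forall n x, ~ Q n (h n x) -> h n.+1 x = h n x) ->
  (forall n, Q n (h n p)) ->
  shrinking Q -> shrinking (fun n => h n @^-1` Q n) ->
  h n p @[n --> \oo] --> z ->
  exists f : auto X, f p = z /\ forall x l, h n x @[n --> \oo] --> l -> f x = l.
Proof.
move=> Qdec hS Qp sQ sP hz.
have Qle m n : (n <= m)%N -> Q m `<=` Q n.
  by move/subnK <-; elim: (m - n)%N => // k IH x /Qdec/IH.
have hC m n x : (n <= m)%N -> ~ Q n (h n x) -> h m x = h n x.
  move/subnK <- => nQ; elim: (m - n)%N => // k IH; rewrite addSn hS// IH.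
  by move=> Qk; apply: nQ; apply: Qle Qk; rewrite leq_addl.
have hQ m n x : (n <= m)%N -> Q n (h n x) -> Q n (h m x).
  move=> nm Qx; apply: contrapT => nQ; apply: nQ.
  pose w := bw (h n) (h m x).
  have [Qw|nQw] := pselect (Q n (h n w)); first by move: Qw; rewrite /w bwK.
  have /fw_inj wx : h m w = h m x by rewrite (hC m n)// /w bwK.
  by exfalso; apply: nQw; rewrite wx.
have bC m n y : (n <= m)%N -> ~ Q n y -> bw (h m) y = bw (h n) y.
  move=> nm nQ; apply: (@fw_inj _ (h m)); rewrite bwK (hC m n)// bwK//.
have bQ m n y : (n <= m)%N -> Q n y -> Q n (h n (bw (h m) y)).
  move=> nm Qy; apply: contrapT => nQ; apply: (nQ).
  by rewrite -(hC m n)// bwK.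
have [|||y|f fH] := @limit_auto h.
- move=> e e0; have [n nH] := sQ e e0; exists n => m nm x.
  have [Qx|nQx] := pselect (Q n (h n x)); last by rewrite (hC m n)// mdistxx.
  by apply: nH => //; exact: hQ.
- move=> e e0; have [n nH] := sP e e0; exists n => m nm y.
  have [Qy|nQy] := pselect (Q n y); last by rewrite (bC m n)// mdistxx.
  by apply: nH => /=; exact: bQ.
- move=> x; have [->|/eqP] := pselect (x = p); first by exists z.
  rewrite -mdist_gt0 => /sP[n nH]; exists (h n x).
  apply: (@cvg_eventually _ _ n) => m nm; apply: hC => // Qx.
  by have := nH x p Qx (Qp n); rewrite ltxx.
- have [[n nQ]|aQ] := pselect (exists n, ~ Q n y).
    exists (bw (h n) y); apply: (@cvg_eventually _ _ n) => m nm; exact: bC.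
  have {}aQ n : Q n y by apply: contrapT => nQ; apply: aQ; exists n.
  exists p; apply/metric_cvgP => e /sP[n nH]; exists n => m nm.
  by apply: nH; [exact: bQ|exact: Qp].
exists f; split; first exact: metric_lim_unique (fH p) hz.
by move=> x l; exact: metric_lim_unique.
Qed.

(** On the annulus [a^n K] minus [a^(n+1) K] the limit is [b^n g a^-n].  Since
[g a = b] on [K] these pieces fit together, and they exhaust [K] minus [p]
on one side and [K] minus [q] on the other. *)
Lemma swindle (a b g : auto X) (K : set X) (p q : X) :
  (forall x, K x -> K (a x)) -> (forall x, K x -> g (a x) = b x) ->
  supported g K ->
  (forall n, K (iter n (bw a) p)) -> (forall n, K (iter n (bw b) q)) ->
  shrinking (fun n => iter n (bw a) @^-1` K) ->
  shrinking (fun n => iter n (bw b) @^-1` K) ->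
  moves K p q.
Proof.
move=> aK gab gK Kp Kq sa sb.
have bK x : K x -> K (b x).
  by move=> Kx; rewrite -gab//; apply: supported_stable => //; exact: aK.
(* The composite [g (a g a^-1) ... (a^(n-1) g a^-(n-1))], which differs from its
successor only on [a^n K]. *)
pose h n := auto_comp (auto_iter (auto_comp g a) n) (auto_inv (auto_iter a n)).
pose Q n := iter n (bw b) @^-1` K.
have hE n x : h n x = iter n (g \o a) (iter n (bw a) x) by [].
have gaE n w : K w -> iter n (g \o a) w = iter n b w.
  by elim: n w => // n IH w Kw; rewrite !iterSr /= gab// IH//; exact: bK.
have hS n x : h n.+1 x = iter n (g \o a) (g (iter n (bw a) x)).
  by rewrite hE iterSr /= bwK.
have PQ n x : Q n (h n x) <-> K (iter n (bw a) x).
  rewrite -[Q n (h n x)]/(K (iter n (bw b) (h n x))) hE; split; last first.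
    by move=> Kx; rewrite gaE//= (iter_cancel n (@fwK _ b)).
  set w := iter n (bw a) x; set y := iter n _ w => Ky.
  have := gaE n _ Ky; rewrite (iter_cancel n (@bwK _ b)) /y.
  by move=> /(@fw_inj _ (auto_iter (auto_comp g a) n)) <-.
have Qle n m y : (n <= m)%N -> Q m y -> Q n y.
  move/subnK <-; elim: (m - n)%N => // k IH; rewrite addSn => Qy; apply: IH.
  by move: (bK _ Qy); rewrite iterS bwK.
have [|n x|||||f [fp fl]] := @nested_limit h Q p q.
- by move=> n y; apply: Qle.
- by rewrite PQ => nK; rewrite hS gK.
- by move=> n; apply/PQ.
- exact: sb.
- by move=> e /sa[n nH]; exists n => x y /PQ Kx /PQ Ky; exact: nH.
- apply/metric_cvgP => e /sb[n nH]; exists n => m nm.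
  by apply: nH; [apply: Qle nm _; apply/PQ|exact: Kq].
exists f; split => // x nK; apply: fl.
apply: (@cvg_eventually _ _ 0) => n _; elim: n => // n IH.
have [Kx|nKx] := pselect (K (iter n (bw a) x)); last first.
  by rewrite hS gK// -hE.
exfalso; apply: nK; elim: n Kx {IH} => // n IH Kx; apply: IH.
by move: (aK _ Kx); rewrite iterS bwK.
Qed.
End Limits.

(** * Radial homeomorphisms of cone charts *)

Section Bump.
Variable R : realType.
Implicit Types l a b c s t : R.

(** The piecewise affine homeomorphism that is the identity off [l, c] and sends
[a] to [b].  Written with a tent function it is visibly continuous, and
exchanging [a] and [b] gives the inverse. *)
Definition bump l a b c s : R :=
  s + (b - a) * Num.max 0 (Num.min ((s - l) / (a - l)) ((c - s) / (c - a))).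

Lemma bump_continuous l a b c : continuous (bump l a b c).
Proof.
move=> s; apply: cvgD; first exact: cvg_id.
apply: cvgM; first exact: cvg_cst.
apply: (@continuous_max R R (fun=> 0)
  (fun s => Num.min ((s - l) / (a - l)) ((c - s) / (c - a))) s).
  exact: cvg_cst.
apply: (@continuous_min R R (fun s => (s - l) / (a - l)) (fun s => (c - s) / (c - a))).
- by apply: cvgM; [apply: cvgB; [exact: cvg_id|exact: cvg_cst]|exact: cvg_cst].
- by apply: cvgM; [apply: cvgB; [exact: cvg_cst|exact: cvg_id]|exact: cvg_cst].
Qed.

Lemma bump_out l a b c s : l < a -> a < c -> s <= l \/ c <= s -> bump l a b c s = s.
Proof.
move=> la ac H; rewrite /bump; set m := Num.min _ _.
suff m0 : m <= 0 by rewrite (max_idPl m0) mulr0 addr0.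
rewrite /m ge_min; apply/orP; case: H => H; [left|right].
  by rewrite pmulr_lle0 ?invr_gt0; lra.
by rewrite pmulr_lle0 ?invr_gt0; lra.
Qed.

Lemma bump_lo l a b c t : l < a -> a < c -> 0 <= t <= 1 ->
  bump l a b c (l + t * (a - l)) = l + t * (b - l).
Proof.
move=> la ac /andP[t0 t1]; rewrite /bump.
have -> : (l + t * (a - l) - l) / (a - l) = t by field; lra.
have -> : Num.min t ((c - (l + t * (a - l))) / (c - a)) = t.
  apply/min_idPl; rewrite ler_pdivlMr; last by lra.
  have : 0 <= (1 - t) * (c - l) by apply: mulr_ge0; lra.
  lra.
rewrite (max_idPr t0); ring.
Qed.

Lemma bump_hi l a b c t : l < a -> a < c -> 0 <= t <= 1 ->
  bump l a b c (c - t * (c - a)) = c - t * (c - b).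
Proof.
move=> la ac /andP[t0 t1]; rewrite /bump.
have -> : (c - (c - t * (c - a))) / (c - a) = t by field; lra.
have -> : Num.min ((c - t * (c - a) - l) / (a - l)) t = t.
  apply/min_idPr; rewrite ler_pdivlMr; last by lra.
  have : 0 <= (1 - t) * (c - l) by apply: mulr_ge0; lra.
  lra.
rewrite (max_idPr t0); ring.
Qed.

(** On each affine piece the parameter [t] is the value of the tent function. *)
Variant bump_case l a c s : Prop :=
  | BumpOut of s <= l \/ c <= s
  | BumpLo t of 0 <= t <= 1 & s = l + t * (a - l)
  | BumpHi t of 0 <= t <= 1 & s = c - t * (c - a).

Lemma bumpP l a c s : l < a -> a < c -> bump_case l a c s.
Proof.
move=> la ac.
have [sl|ls] := lerP s l; first by apply: BumpOut; left.
have [cs|sc] := lerP c s; first by apply: BumpOut; right.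
have [sa|as_] := lerP s a.
  apply: (@BumpLo _ _ _ _ ((s - l) / (a - l))); last by field; lra.
  apply/andP; split; first by apply: divr_ge0; lra.
  by rewrite ler_pdivrMr; lra.
apply: (@BumpHi _ _ _ _ ((c - s) / (c - a))); last by field; lra.
apply/andP; split; first by apply: divr_ge0; lra.
by rewrite ler_pdivrMr; lra.
Qed.

Lemma bumpK l a b c : l < a -> a < c -> l < b -> b < c ->
  cancel (bump l a b c) (bump l b a c).
Proof.
move=> la ac lb bc s; case: (bumpP s la ac) => [H|t t01 ->|t t01 ->].
- by rewrite !bump_out.
- by rewrite !bump_lo.
- by rewrite !bump_hi.
Qed.

Lemma bump_gt0 l a b c s : 0 <= l -> l < a -> a < c -> l < b -> b < c ->
  0 < s -> 0 < bump l a b c s.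
Proof.
move=> l0 la ac lb bc s0; case: (bumpP s la ac) => [H|t /andP[t0 t1] E|t /andP[t0 t1] ->].
- by rewrite bump_out.
- rewrite E bump_lo//; last by rewrite t0.
  have [l1|l1] := ltrP 0 l.
    have : 0 <= t * (b - l) by apply: mulr_ge0; lra.
    lra.
  have t2 : 0 < t.
    rewrite lt_neqAle t0 andbT; apply/eqP => t2; move: s0.
    by rewrite E -t2 mul0r; lra.
  have : 0 < t * (b - l) by apply: mulr_gt0; lra.
  lra.
- rewrite bump_hi//; last by rewrite t0.
  have : 0 <= (1 - t) * (c - b) by apply: mulr_ge0; lra.
  lra.
Qed.

Lemma bump_lt1 l a b c s : l < a -> a < c -> l < b -> b < c -> c <= 1 ->
  s < 1 -> bump l a b c s < 1.
Proof.
move=> la ac lb bc c1 s1; case: (bumpP s la ac) => [H|t /andP[t0 t1] E|t /andP[t0 t1] E].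
- by rewrite bump_out.
- rewrite E bump_lo//; last by rewrite t0.
  have : 0 <= (1 - t) * (b - l) by apply: mulr_ge0; lra.
  lra.
- rewrite E bump_hi//; last by rewrite t0.
  have [c2|c2] := ltrP c 1.
    have : 0 <= t * (c - b) by apply: mulr_ge0; lra.
    lra.
  have t2 : 0 < t.
    rewrite lt_neqAle t0 andbT; apply/eqP => t2; move: s1.
    by rewrite E -t2 mul0r; lra.
  have : 0 < t * (c - b) by apply: mulr_gt0; lra.
  lra.
Qed.

Lemma bump_le l a b c s : l < a -> a < c -> l < b -> s <= a -> bump l a b c s <= b.
Proof.
move=> la ac lb sa; case: (bumpP s la ac) => [H|t /andP[t0 t1] E|t /andP[t0 t1] E].
- by rewrite bump_out//; lra.
- rewrite E bump_lo//; last by rewrite t0.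
  have : 0 <= (1 - t) * (b - l) by apply: mulr_ge0; lra.
  lra.
- have t2 : t = 1.
    apply/eqP; rewrite eq_le t1 /= -(ler_pM2r (_ : 0 < c - a)); lra.
  by rewrite E t2 bump_hi//; lra.
Qed.

Lemma bump_agree l l' a b c s : l < a -> l' < a -> a < c -> a <= s ->
  bump l a b c s = bump l' a b c s.
Proof.
move=> la la' ac sa; case: (bumpP s la ac) => [H|t /andP[t0 t1] E|t /andP[t0 t1] E].
- have cs : c <= s by lra.
  by rewrite !bump_out//; right.
- have t2 : t = 1.
    apply/eqP; rewrite eq_le t1 /= -(ler_pM2r (_ : 0 < a - l)); lra.
  have -> : s = c - 1 * (c - a) by rewrite E t2; ring.
  by rewrite !bump_hi//; lra.
- by rewrite E !bump_hi//; rewrite t0.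
Qed.

End Bump.

Section Charts.
Variables (R : realType) (X : metricType R) (Y : topologicalType).

(** The height [u] vanishes at the apex and is extended by 1 off the cone, so it
is defined and continuous on the whole space; [k y s] is the point of height [s]
on the ray of [y].  Only heights strictly between 0 and 1 are constrained, since
all rays meet at the apex. *)
Record cone_chart (p : X) (u : X -> R) (k : Y -> R -> X) : Prop := ConeChart {
  chart_continuous : continuous u;
  chart_ge0 : forall x, 0 <= u x;
  chart_le1 : forall x, u x <= 1;
  chart_apex : u p = 0;
  chart_eq0 : forall x, u x = 0 -> x = p;
  chart_compact : forall c, c < 1 -> compact [set x | u x <= c];
  chart_height : forall y s, 0 < s < 1 -> u (k y s) = s;
  chart_inj : forall y y' s, 0 < s < 1 -> k y s = k y' s -> y = y';
  chart_surj : forall x, 0 < u x < 1 -> exists y, x = k y (u x);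
  chart_ray_continuous : forall y s, 0 < s < 1 ->
    {for (y, s), continuous (fun z => k z.1 z.2)};
  chart_box_open : forall O : set Y, open O ->
    open [set x | 0 < u x < 1 /\ exists2 y, O y & x = k y (u x)] }.

Section OneChart.
Variables (p : X) (u : X -> R) (k : Y -> R -> X).
Hypothesis C : cone_chart p u k.

Lemma open_lt_chart c : open [set x | u x < c].
Proof.
rewrite (_ : [set _ | _] = u @^-1` [set y | y < c])//.
by move/continuousP: (chart_continuous C); apply; exact: open_lt.
Qed.

Lemma open_gt_chart c : open [set x | c < u x].
Proof.
rewrite (_ : [set _ | _] = u @^-1` [set y | c < y])//.
by move/continuousP: (chart_continuous C); apply; exact: open_gt.
Qed.

(** On the compact set of points of height at most 1/2 outside [N] the height is
bounded away from 0. *)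
Lemma chart_basis (N : set X) : open N -> N p ->
  exists2 c, 0 < c < 1 & [set x | u x <= c] `<=` N.
Proof.
move=> oN Np.
pose K := [set x | u x <= 1 / 2] `&` ~` N.
have cK : compact K.
  by apply: compact_closedI; [apply: (chart_compact C); lra|exact: open_closedC].
have cuK : compact (u @` K).
  by apply: continuous_compact => //; apply: continuous_subspaceT; exact: (chart_continuous C).
have oK : open (~` (u @` K)).
  by apply: closed_openC; apply: compact_closed => //; exact: Rhausdorff.
have K0 : (~` (u @` K)) 0.
  by move=> [x [_ nN]] /(chart_eq0 C) E; apply: nN; rewrite E.
have /nbhs_ballP[e /= e0 eK] := open_nbhs_nbhs (conj oK K0).
have e2 : 0 < Num.min (1 / 2) (e / 2) by rewrite lt_min; apply/andP; split; lra.
have m1 : Num.min (1 / 2) (e / 2) <= 1 / 2 :> R by rewrite ge_min lexx.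
have m2 : Num.min (1 / 2) (e / 2) <= e / 2 :> R by rewrite ge_min lexx orbT.
exists (Num.min (1 / 2) (e / 2)); first lra.
move=> x /= ux; apply: contrapT => nN.
apply: (eK (u x)); last by exists x => //; split => //=; lra.
by rewrite /ball /= sub0r normrN ger0_norm; [lra|exact: (chart_ge0 C)].
Qed.

Definition is_radial (phi : R -> R) (f : X -> X) :=
  (forall y s, 0 < s < 1 -> f (k y s) = k y (phi s)) /\
  (forall x, ~ (0 < u x < 1) -> f x = x).

Lemma is_radial_exists phi : exists f, is_radial phi f.
Proof.
have /choice[f fH] : forall x, exists z,
    (forall y s, 0 < s < 1 -> x = k y s -> z = k y (phi s))
    /\ (~ (0 < u x < 1) -> z = x).
  move=> x; have [ux|nux] := pselect (0 < u x < 1); last first.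
    exists x; split => // y s s01 xk; exfalso; apply: nux.
    by rewrite xk (chart_height C).
  have [y xy] := chart_surj C ux; exists (k y (phi (u x))); split => // y' s s01 xk.
  move: (xk) => /(congr1 u); rewrite (chart_height C)// => us.
  by rewrite us in xy; rewrite us (@chart_inj _ _ _ C y y' s)// -xy.
exists f; split => [y s s01|x nx]; first exact: (fH _).1.
exact: (fH x).2.
Qed.

Section Radial.
Variables (phi : R -> R) (f : X -> X).
Hypothesis rf : is_radial phi f.
Hypothesis phi0 : phi 0 = 0.
Hypothesis phi01 : forall s, 0 < s < 1 -> 0 < phi s < 1.

Lemma radial_fix x : phi (u x) = u x -> f x = x.
Proof.
move=> px; have [ux|nux] := pselect (0 < u x < 1); last exact: rf.2.
by have [y xy] := chart_surj C ux; rewrite {1}xy rf.1// px -xy.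
Qed.

Lemma radial_height x : phi 1 = 1 -> u (f x) = phi (u x).
Proof.
move=> phi1; have [ux|nux] := pselect (0 < u x < 1); last first.
  rewrite rf.2//; have := chart_ge0 C x; have := chart_le1 C x => u1 u0.
  have [->|->] : u x = 0 \/ u x = 1; last 2 first.
  - by rewrite phi0.
  - by rewrite phi1.
  have [u2|u2] := ltrP 0 (u x); last by left; lra.
  have [u3|u3] := ltrP (u x) 1; last by right; lra.
  by exfalso; apply: nux; rewrite u2.
have [y xy] := chart_surj C ux.
by rewrite {1}xy rf.1// (chart_height C)//; exact: phi01.
Qed.

(** Three regions: far out [f] is the identity; at the apex only the height
matters, by [chart_basis]; in between the rays give product coordinates. *)
Lemma radial_continuous c : c < 1 -> (forall s, c <= s -> phi s = s) ->
  continuous phi -> continuous f.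
Proof.
move=> c1 phic cphi x.
have phi1 : phi 1 = 1 by rewrite phic// ltW.
have cu := chart_continuous C.
have [cx|xc] := ltrP c (u x).
  have fx : f x = x by apply: radial_fix; rewrite phic// ltW.
  move=> A; rewrite fx => xA.
  have : nbhs x [set z | c < u z] by apply: open_nbhs_nbhs; split => //; exact: open_gt_chart.
  move=> N1; apply: filterS (filterI N1 xA) => z [/= cz Az].
  by rewrite /= radial_fix// phic// ltW.
have [x0|xn0] := eqVneq (u x) 0.
  have xp := chart_eq0 C x0.
  move=> A; rewrite radial_fix ?x0// => xA.
  have := xA; rewrite {1}nbhsE => -[B [oB Bx] BA].
  rewrite xp in Bx; have [d /andP[d0 d1] dB] := chart_basis oB Bx.
  have : nbhs x ((phi \o u) @^-1` [set y | y < d]).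
    apply: (continuous_comp (cu x) (cphi (u x))).
    by apply: open_nbhs_nbhs; split; [exact: open_lt|rewrite /= x0 phi0].
  move=> N1; apply: filterS N1 => z /= zd; apply/BA/dB => /=.
  by rewrite radial_height// ltW.
have ux : 0 < u x < 1 by rewrite lt_neqAle eq_sym xn0 (chart_ge0 C)/=; lra.
have [y0 xy] := chart_surj C ux.
move=> A; rewrite {1}xy rf.1// => xA.
have [ [V S] /= [nV nS] VSA] := @chart_ray_continuous _ _ _ C y0 _ (phi01 ux) A xA.
move: nV; rewrite {1}nbhsE => -[V' [oV Vy] VV].
have nS' : nbhs x ((phi \o u) @^-1` S) by apply: (continuous_comp (cu x) (cphi (u x))).
have : nbhs x [set z | 0 < u z < 1 /\ exists2 y, V' y & z = k y (u z)].
  apply: open_nbhs_nbhs; split; first exact: (chart_box_open C).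
  by split => //; exists y0.
move=> N1; apply: filterS (filterI N1 nS') => z [ [uz [y V'y' zy]] Sz].
rewrite /= {1}zy rf.1//.
by apply: (VSA (y, phi (u z))); split => //; exact: VV.
Qed.

End Radial.

Lemma radial_bump l a b c : 0 <= l -> l < a -> a < c -> l < b -> b < c -> c < 1 ->
  exists f : auto X, [/\ is_radial (bump l a b c) f,
    is_radial (bump l b a c) (bw f),
    forall x, u (f x) = bump l a b c (u x) &
    forall x, u (bw f x) = bump l b a c (u x)].
Proof.
move=> l0 la ac lb bc c1.
have [f rf] := is_radial_exists (bump l a b c).
have [g rg] := is_radial_exists (bump l b a c).
have f01 s : 0 < s < 1 -> 0 < bump l a b c s < 1.
  by move=> /andP[s0 s1]; rewrite bump_gt0// bump_lt1// ltW.
have g01 s : 0 < s < 1 -> 0 < bump l b a c s < 1.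
  by move=> /andP[s0 s1]; rewrite bump_gt0// bump_lt1// ltW.
have fg phi psi (F G : X -> X) : is_radial phi F -> is_radial psi G ->
    (forall s, 0 < s < 1 -> 0 < phi s < 1) -> cancel phi psi -> cancel F G.
  move=> rF rG p01 pK x; have [ux|nux] := pselect (0 < u x < 1); last first.
    by rewrite rF.2// rG.2.
  by have [y xy] := chart_surj C ux; rewrite xy rF.1// rG.1 ?pK//; exact: p01.
have fK : cancel f g by apply: (fg _ _ _ _ rf rg) => //; exact: bumpK.
have gK : cancel g f by apply: (fg _ _ _ _ rg rf) => //; exact: bumpK.
have cf : continuous f.
  apply: (radial_continuous rf _ f01 c1); [by rewrite bump_out//; left| |].
    by move=> s cs; rewrite bump_out//; right.
  exact: bump_continuous.
have cg : continuous g.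
  apply: (radial_continuous rg _ g01 c1); [by rewrite bump_out//; left| |].
    by move=> s cs; rewrite bump_out//; right.
  exact: bump_continuous.
exists (Auto fK gK cf cg); split => //= x.
  by apply: radial_height => //; rewrite bump_out//; [left|right; rewrite ltW].
by apply: radial_height => //; rewrite bump_out//; [left|right; rewrite ltW].
Qed.

(** Below [a] the bump with [l = 0] is multiplication by [b / a < 1], so the
iterates drive the height to 0. *)
Lemma contraction_shrinking a b c (f : auto X) :
  0 < b -> b < a -> a < c -> (forall x, u (f x) = bump 0 a b c (u x)) ->
  shrinking (fun n => iter n (bw f) @^-1` [set x | u x <= a]).
Proof.
move=> b0 ba ac uf e e0.
have hx x n : u x <= a -> u (iter n f x) <= (b / a) ^+ n * a.
  move=> ux; elim: n => [|n IH]; first by rewrite expr0 mul1r.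
  rewrite iterS uf; set s := u _ in IH *.
  have s0 : 0 <= s by exact: (chart_ge0 C).
  have ba1 : (b / a) ^+ n <= 1.
    by apply: exprn_ile1; [apply: divr_ge0; lra|rewrite ler_pdivrMr; lra].
  have sa : s <= a.
    by apply: le_trans IH _; apply: ler_piMl => //; lra.
  have -> : s = 0 + (s / a) * (a - 0) by field; lra.
  rewrite bump_lo; [|lra|lra|]; last first.
    by rewrite divr_ge0//= ?ler_pdivrMr; lra.
  have -> : 0 + s / a * (b - 0) = (b / a) * s by field; lra.
  by rewrite exprS -[leRHS]mulrA ler_wpM2l//; apply: divr_ge0; lra.
have oB := open_mball p (e / 2).
have [|d /andP[d0 d1] dB] := chart_basis oB; first by rewrite /= mdistxx; lra.
have r1 : `|b / a| < 1.
  by rewrite ger0_norm; [rewrite ltr_pdivrMr; lra|apply: divr_ge0; lra].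
have /cvgrPdist_lt/(_ (d / a) ltac:(apply: divr_gt0; lra))[n _ nH] := cvg_expr r1.
have nd : (b / a) ^+ n * a <= d.
  have := nH n (leqnn n); rewrite /= sub0r normrN ger0_norm; last first.
    by apply: exprn_ge0; apply: divr_ge0; lra.
  by rewrite ltr_pdivlMr; lra.
have near x : u (iter n (bw f) x) <= a -> mdist p x < e / 2.
  move=> /(hx _ n); rewrite (iter_cancel n (@bwK _ f)) => ux.
  by apply: dB => /=; lra.
exists n => x y /near px /near py.
by have := metric_triangle x p y; rewrite (metric_sym x p); lra.
Qed.

Lemma radial_agree phi psi f g x : is_radial phi f -> is_radial psi g ->
  phi (u x) = psi (u x) -> f x = g x.
Proof.
move=> rf rg E; have [ux|nux] := pselect (0 < u x < 1); last by rewrite rf.2// rg.2.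
by have [y xy] := chart_surj C ux; rewrite xy rf.1// rg.1// E.
Qed.

End OneChart.

Lemma chart_auto (h : auto X) p u k :
  cone_chart p u k -> cone_chart (h p) (u \o bw h) (fun y s => h (k y s)).
Proof.
move=> C; split.
- by move=> x; apply: continuous_comp; [exact: bw_cont|exact: (chart_continuous C)].
- by move=> x; exact: (chart_ge0 C).
- by move=> x; exact: (chart_le1 C).
- by rewrite /= fwK (chart_apex C).
- by move=> x /(chart_eq0 C) <-; rewrite bwK.
- move=> c /(chart_compact C) cc.
  rewrite (_ : [set _ | _] = h @` [set x | u x <= c]).
    apply: continuous_compact => //; apply: continuous_subspaceT; exact: fw_cont.
  apply/seteqP; split => [x /= ux|_ [x /= ux <-]]; last by rewrite fwK.
  by exists (bw h x) => //; rewrite bwK.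
- by move=> y s s01; rewrite /= fwK (chart_height C).
- by move=> y y' s s01 /fw_inj; exact: (chart_inj C).
- by move=> x /(chart_surj C)[y xy]; exists y; rewrite /= -xy bwK.
- move=> y s s01.
  by apply: continuous_comp; [exact: (chart_ray_continuous C)|exact: fw_cont].
- move=> O /(chart_box_open C) oO.
  rewrite (_ : [set _ | _] = bw h @^-1` [set x | 0 < u x < 1 /\ exists2 y, O y & x = k y (u x)]).
    by move/continuousP: (@bw_cont _ h); apply.
  apply/seteqP; split => x /= [ux [y Oy xy]]; split => //; exists y => //.
    by rewrite {1}xy fwK.
  by rewrite -xy bwK.
Qed.

(** With [f] contracting towards [p], [g] towards [q], and [t] agreeing with [g]
above height [b2] but fixing the heights below [b0], the composite
[g f^-1 t^-1] is the intertwiner that [swindle] asks for. *)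
Lemma chart_swindle p q u v k m a1 a2 a3 b0 b1 b2 :
  cone_chart p u k -> cone_chart q v m ->
  0 < a1 -> a1 < a2 -> a2 < a3 -> a3 < 1 ->
  0 < b0 -> b0 < b1 -> b1 < b2 -> b2 < 1 ->
  [set x | u x <= a1] `<=` [set x | v x <= b0] ->
  [set x | v x <= b1] `<=` [set x | u x <= a2] ->
  [set x | u x <= a3] `<=` [set x | v x <= b2] ->
  moves [set x | v x <= b1] p q.
Proof.
move=> Cu Cv a10 a12 a23 a31 b00 b01 b12 b21 uv1 vu uv2.
(* Any height in between would do; it bounds the supports of [g] and [t]. *)
pose b3 := (b2 + 1) / 2.
have [b23 b31] : b2 < b3 /\ b3 < 1 by rewrite /b3; lra.
have [f [rf rf' uf uf']] : exists f : auto X, [/\ is_radial u k (bump 0 a2 a1 a3) f,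
    is_radial u k (bump 0 a1 a2 a3) (bw f),
    forall x, u (f x) = bump 0 a2 a1 a3 (u x) &
    forall x, u (bw f x) = bump 0 a1 a2 a3 (u x)] by apply: (radial_bump Cu); lra.
have [g [rg rg' vg vg']] : exists f : auto X, [/\ is_radial v m (bump 0 b2 b1 b3) f,
    is_radial v m (bump 0 b1 b2 b3) (bw f),
    forall x, v (f x) = bump 0 b2 b1 b3 (v x) &
    forall x, v (bw f x) = bump 0 b1 b2 b3 (v x)] by apply: (radial_bump Cv); lra.
have [t [rt rt' vt vt']] : exists f : auto X, [/\ is_radial v m (bump b0 b2 b1 b3) f,
    is_radial v m (bump b0 b1 b2 b3) (bw f),
    forall x, v (f x) = bump b0 b2 b1 b3 (v x) &
    forall x, v (bw f x) = bump b0 b1 b2 b3 (v x)] by apply: (radial_bump Cv); lra.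
apply: (@swindle _ _ f g (auto_comp g (auto_comp (auto_inv f) (auto_inv t)))) => /=.
- move=> x vx; have : v (f x) <= b0.
    by apply/uv1; rewrite /= uf; apply: bump_le; try lra; exact: vu.
  lra.
- move=> x vx; have vfx : v (f x) <= b0.
    by apply/uv1; rewrite /= uf; apply: bump_le; try lra; exact: vu.
  have -> : bw t (f x) = f x.
    by apply: (radial_fix Cv rt'); rewrite bump_out; [by []|lra|lra|by left].
  by rewrite fwK.
- move=> x /= nvx; set w := bw t x.
  have vw : b2 < v w.
    rewrite ltNge; apply/negP => vw; apply: nvx.
    by rewrite -(bwK t x) vt; apply: bump_le => //; lra.
  have -> : bw f w = w.
    apply: (radial_fix Cu rf'); rewrite bump_out; [by []|lra|lra|right].
     rewrite leNgt; apply/negP => uw.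
    by have /= := uv2 w (ltW uw); lra.
  rewrite -[RHS](bwK t x) -/w; apply: (radial_agree Cv rg rt).
  by apply: bump_agree; lra.
- move=> n; suff -> : iter n (bw f) p = p.
    have : v p <= b0 by apply: uv1; rewrite /= (chart_apex Cu); lra.
    lra.
  elim: n => //= n ->; apply: (radial_fix Cu rf').
  by rewrite (chart_apex Cu) bump_out; [by []|lra|lra|by left].
- move=> n; suff -> : iter n (bw g) q = q by rewrite (chart_apex Cv); lra.
  elim: n => //= n ->; apply: (radial_fix Cv rg').
  by rewrite (chart_apex Cv) bump_out; [by []|lra|lra|by left].
- move=> e e0; have [] := contraction_shrinking Cu a10 a12 a23 uf e0 => n nH.
  by exists n => x y vx vy; apply: nH; exact: vu.
- have b10 : 0 < b1 by lra.
  move=> e e0; have [] := contraction_shrinking Cv b10 b12 b23 vg e0 => n nH.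
  by exists n => x y /= vx vy; apply: nH => /=; lra.
Qed.

End Charts.

(** * The chart of an open cone *)

Section ConeChart.
Variables (R : realType) (X : metricType R) (Y : topologicalType).

Lemma contract_continuous : continuous (@contract R).
Proof.
move=> t A /nbhs_ballP[e /= e0 eA]; apply/nbhs_ballP; exists e => // s ts.
by apply: eA.
Qed.

Lemma expand_continuous_at (s : R) : -1 < s -> {for s, continuous (@expand R)}.
Proof.
move=> s1 A /nbhs_ballP[e /= e0 eA].
have cs r : -1 < r -> contract (expand r) = Num.min 1 r.
  move=> r1; case: (lerP 1 r) => r2; first by rewrite expand1//.
  by apply: expandK; rewrite inE ler_norml; apply/andP; split; lra.
have H : nbhs s [set r | -1 < r] by apply: open_nbhs_nbhs; split; [exact: open_gt|].
have B : nbhs s (ball s e) by exact: nbhsx_ballx.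
apply: filterS (filterI H B) => r [/= r1 sr]; apply: eA.
rewrite /ball /= /ereal_ball !cs //; move: sr; rewrite /ball /= !ltr_norml.
by case: (lerP 1 s); case: (lerP 1 r); lra.
Qed.

Lemma cvg_set_type (T : topologicalType) (Z : topologicalType) (A : set Z)
    (f : T -> A) x :
  {for x, continuous (set_val \o f)} -> {for x, continuous f}.
Proof.
move=> cf V; rewrite {1}nbhsE => -[V' [[W oW <-] Wx] V'V].
have : nbhs x ((set_val \o f) @^-1` W) by apply: cf; exact: open_nbhs_nbhs.
by apply: filterS => z Wz; apply: V'V.
Qed.

Lemma nbhs_set_val (A : set X) (w : A) (V : set A) : open A ->
  nbhs w V -> nbhs (set_val w) (set_val @` V).
Proof.
move=> oA; rewrite {1}nbhsE => -[V' [[W oW <-] Wx] V'V].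
have : nbhs (set_val w) (W `&` A).
  by apply: open_nbhs_nbhs; split; [exact: openI|split => //; exact: set_valP].
apply: filterS => z [Wz Az]; exists (exist _ z (mem_set Az)) => //.
exact: V'V.
Qed.

Local Notation cyl := (cone_cylinder R Y).
Local Notation cone := (open_cone R Y).

Definition cone_pi (a : cyl) : cone :=
  (\pi_(quotient_topology {eq_quot (@cone_equiv R Y)}) a)%qT.

(** Heights run backwards: the vertex has parameter [+oo] and height 0. *)
Definition cone_height (a : cyl) : R := 1 - contract (set_val a.2).

Lemma cone_pi_continuous : continuous cone_pi.
Proof. exact: pi_continuous. Qed.

Lemma cone_piP a b : cone_pi a = cone_pi b <-> cone_rel a b.
Proof.
split => [H|H]; first by apply/(@eqmodP _ (@cone_equiv R Y)).
exact/(@eqmodP _ (@cone_equiv R Y)).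
Qed.

Lemma cone_pi_surj c : exists a, c = cone_pi a.
Proof. by exists (repr c); rewrite /cone_pi reprK. Qed.

Lemma cone_height_rel a b : cone_rel a b -> cone_height a = cone_height b.
Proof.
rewrite /cone_rel => /orP[/eqP -> //|/andP[/eqP a1 /eqP b1]].
by rewrite /cone_height a1 b1.
Qed.

Lemma cone_height_continuous : continuous cone_height.
Proof.
move=> a; apply: cvgB; first exact: cvg_cst.
apply: (@continuous_comp _ _ _ (fun a : cyl => set_val a.2)); last exact: contract_continuous.
apply: (@continuous_comp _ _ _ (fun a : cyl => a.2)); first exact: cvg_snd.
exact: initial_continuous.
Qed.

Lemma cone_height_bounds a : 0 <= cone_height a < 1.
Proof.
rewrite /cone_height; apply/andP; split.
  by have := contract_le1 (set_val a.2); rewrite ler_norml; lra.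
have : (0 < set_val a.2)%E by have := set_valP a.2.
by rewrite -lt_contract contract0; lra.
Qed.

(** The second branch only makes the function total; it is taken when [1 <= s]. *)
Definition cone_level (s : R) : set_type (@half_open R) :=
  if pselect (half_open (expand (1 - s))) is left H
  then exist (fun t => t \in @half_open R) _ (mem_set H)
  else exist (fun t => t \in @half_open R) +oo%E (mem_set ((@lt0y R) : half_open (+oo%E : \bar R))).

Lemma cone_levelE s : s < 1 -> set_val (cone_level s) = expand (1 - s).
Proof.
move=> s1; rewrite /cone_level; case: pselect => // nH; exfalso; apply: nH.
rewrite /half_open /= -lt_contract contract0.
have [s0|s0] := lerP 0 s.
  by rewrite expandK ?inE ?ler_norml; lra.
by rewrite expand1 ?contract1//=; lra.
Qed.

Lemma cone_height_level y s : 0 <= s < 1 -> cone_height (y, cone_level s) = s.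
Proof.
move=> /andP[s0 s1]; rewrite /cone_height /= cone_levelE// expandK.
  by ring.
by rewrite inE ler_norml; lra.
Qed.

Lemma cone_level_height (a : cyl) : cone_level (cone_height a) = a.2.
Proof.
apply: val_inj; have /andP[h0 h1] := cone_height_bounds a.
rewrite -[LHS]/(set_val _) cone_levelE//.
rewrite /cone_height (_ : 1 - (1 - _) = contract (set_val a.2)); last by ring.
by rewrite contractK.
Qed.

Lemma cone_level_oo s : 0 <= s < 1 -> (set_val (cone_level s) == +oo%E) = (s == 0).
Proof.
move=> /andP[s0 s1]; rewrite cone_levelE// expand_eqoo.
by apply/idP/eqP => [|->]; lra.
Qed.

Lemma cone_level_continuous s : s < 1 -> {for s, continuous cone_level}.
Proof.
move=> s1; apply: cvg_set_type.
have E : \near s, expand (1 - s) = (set_val \o cone_level) s.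
  have : nbhs s [set r : R | r < 1] by apply: open_nbhs_nbhs; split; [exact: open_lt|].
  by apply: filterS => r r1; rewrite /= cone_levelE.
suff: set_val (cone_level r) @[r --> s] --> expand (1 - s) by rewrite -cone_levelE.
apply: cvg_trans (near_eq_cvg E) _.
apply: (@continuous_comp _ _ _ (fun s : R => 1 - s)).
  by apply: cvgB; [exact: cvg_cst|exact: cvg_id].
by apply: expand_continuous_at; lra.
Qed.

Section Extract.
Variables (U : set X) (f : U -> cone) (g : cone -> U).
Hypotheses (oU : open U) (cY : compact [set: Y]) (cf : continuous f)
  (cg : continuous g) (fK : cancel f g) (gK : cancel g f).

Definition cone_ray (y : Y) (s : R) : X := set_val (g (cone_pi (y, cone_level s))).

Lemma cone_ray_continuous y s : s < 1 ->
  {for (y, s), continuous (fun z => cone_ray z.1 z.2)}.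
Proof.
move=> s1; rewrite /cone_ray.
apply: (@continuous_comp _ _ _ (fun z : Y * R => g (cone_pi (z.1, cone_level z.2))) set_val);
  last exact: initial_continuous.
apply: (@continuous_comp _ _ _ (fun z : Y * R => cone_pi (z.1, cone_level z.2)) g);
  last exact: cg.
apply: (@continuous_comp _ _ _ (fun z : Y * R => (z.1, cone_level z.2)) cone_pi);
  last exact: cone_pi_continuous.
have c1 : z.1 @[z --> (y, s)] --> y by exact: cvg_fst.
suff c2 : cone_level z.2 @[z --> (y, s)] --> cone_level s by exact: cvg_pair c1 c2.
apply: (@continuous_comp _ _ _ (fun z : Y * R => z.2)); first exact: cvg_snd.
exact: cone_level_continuous.
Qed.

Definition lift_height : cone -> R := cone_height \o repr.

Lemma lift_heightE a : lift_height (cone_pi a) = cone_height a.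
Proof.
by apply: cone_height_rel; apply/cone_piP; rewrite /cone_pi reprK.
Qed.

Lemma lift_height_continuous : continuous lift_height.
Proof.
apply: repr_comp_continuous; first exact: cone_height_continuous.
by move=> a b /eqP H; apply/eqP/cone_height_rel/cone_piP.
Qed.

(** The quotient topology is used only to see that the height is continuous and
that boxes avoiding the vertex are open; compactness of [Y] gives compact
sublevel sets. *)
Lemma open_cone_chart (x0 : X) : U x0 -> exists p u, cone_chart p u cone_ray.
Proof.
move=> Ux0; pose w0 : U := exist _ x0 (mem_set Ux0).
have [[y0 t0] _] := cone_pi_surj (f w0).
have /choice[u uH] : forall x, exists r, (forall w : U, set_val w = x -> r = lift_height (f w))
    /\ (~ U x -> r = 1).
  move=> x; have [Ux|nUx] := pselect (U x).
    exists (lift_height (f (exist _ x (mem_set Ux)))); split => // w wx.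
    by congr (lift_height (f _)); apply: val_inj.
  by exists 1; split => // w wx; exfalso; apply: nUx; rewrite -wx; exact: set_valP.
have uU (w : U) : u (set_val w) = lift_height (f w) by apply: (uH _).1.
have uN x : ~ U x -> u x = 1 by apply: (uH x).2.
have xU x : U x -> exists w : U, set_val w = x by move=> Ux; exists (exist _ x (mem_set Ux)).
have uray y s : 0 <= s < 1 -> u (cone_ray y s) = s.
  by move=> s01; rewrite uU gK lift_heightE cone_height_level.
have ub (w : U) : 0 <= u (set_val w) < 1.
  rewrite uU; have [a ->] := cone_pi_surj (f w).
  by rewrite lift_heightE; exact: cone_height_bounds.
have u1 x : u x < 1 -> U x.
  by move=> ux; apply: contrapT => /uN E; move: ux; rewrite E ltxx.
have usurj x : u x < 1 -> exists y, x = cone_ray y (u x).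
  move=> /u1/xU[w <-]; have [[y t] wa] := cone_pi_surj (f w).
  exists y; rewrite uU /cone_ray wa lift_heightE.
  by rewrite cone_level_height /= -wa fK.
have ucompact c : c < 1 -> compact [set x | u x <= c].
  move=> c1; have cc : compact ([set: Y] `*` `[0, c]%classic).
    by apply: compact_setX => //; exact: segment_compact.
  rewrite (_ : [set _ | _] = (fun z => cone_ray z.1 z.2) @` ([set: Y] `*` `[0, c]%classic)).
    apply: continuous_compact cc; apply: continuous_in_subspaceT => -[y s].
    rewrite inE /= in_itv /= => -[_ /andP[s0 sc]].
    by apply: cone_ray_continuous; lra.
  apply/seteqP; split => [x /= uc|_ [[y s] /= [_ +] <-]].
    have ux : u x < 1 by lra.
    have [y xy] := usurj _ ux; exists (y, u x) => //=; split => //.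
    rewrite in_itv /= uc andbT.
    by have /u1/xU[w <-] := ux; have := ub w; lra.
  by rewrite in_itv /= => /andP[s0 sc]; rewrite uray; lra.
have clf : continuous (lift_height \o f).
  by move=> w; apply: continuous_comp; [exact: cf|exact: lift_height_continuous].
exists (cone_ray y0 0), u; split.
- move=> x; have [/xU[w <-]|nU] := pselect (U x).
    move=> A; rewrite uU => hA.
    have : nbhs w ((lift_height \o f) @^-1` A) by exact: (clf w A hA).
    move=> /(nbhs_set_val oU); apply: filterS => _ [w' Aw' <-].
    by rewrite /= uU.
  move=> A; rewrite uN// => /nbhs_ballP[e /= e0 eA].
  have : nbhs x (~` [set x | u x <= 1 - e / 2]).
    apply: open_nbhs_nbhs; split; last by rewrite /= uN//; lra.
    apply: closed_openC; apply: compact_closed; first exact: metric_hausdorff.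
    by apply: ucompact; lra.
  apply: filterS => z /= /negP; rewrite -ltNge => uz; apply: eA.
  rewrite /ball /= ltr_norml.
  have [/xU[w zw]|nUz] := pselect (U z); last by rewrite uN//; lra.
  by move: uz; rewrite -zw; have := ub w; lra.
- by move=> x; have [/xU[w <-]|/uN ->] := pselect (U x); [have := ub w; lra|].
- by move=> x; have [/xU[w <-]|/uN ->] := pselect (U x); [have := ub w; lra|].
- by rewrite uray; lra.
- move=> x ux; have [|y ->] := usurj x; first by lra.
  rewrite ux; congr (set_val (g _)); apply/cone_piP/orP; right.
  by rewrite /= !cone_level_oo ?eqxx ?lexx ?ltr01.
- exact: ucompact.
- by move=> y s s01; apply: uray; lra.
- move=> y y' s s01 H; have : cone_pi (y, cone_level s) = cone_pi (y', cone_level s).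
    by apply: (can_inj gK); apply: val_inj.
  have /andP[s0 s1] := s01; move=> /cone_piP/orP[/eqP[]//|].
  by rewrite /= cone_level_oo ?s1 ?ltW// andbb => /eqP E; move: s0; rewrite E ltxx.
- by move=> x ux; apply: usurj; lra.
- by move=> y s s01; apply: cone_ray_continuous; lra.
move=> V oV.
pose W : set cone := [set c | 0 < lift_height c /\ exists y t, V y /\ c = cone_pi (y, t)].
have oW : open W.
  rewrite /open /= /quotient_open.
  rewrite (_ : _ @^-1` W = (fst @^-1` V) `&` (cone_height @^-1` [set r | 0 < r])).
    apply: openI.
      by apply: open_comp => // z _; exact: cvg_fst.
    by apply: open_comp => [z _|]; [exact: cone_height_continuous|exact: open_gt].
  apply/seteqP; split => [a|[y t] [Vy h0]]; last first.
    by split; [rewrite lift_heightE|exists y, t].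
  rewrite /= -/(cone_pi a) /W /= lift_heightE => -[h0 [y [t [Vy /cone_piP]]]].
  move=> /orP[/eqP aE|/andP[/eqP a1 _]]; first by split => //; rewrite /= aE.
  by move: h0; rewrite /cone_height a1 /=; lra.
have ofW : open (f @^-1` W) by move/continuousP: cf; apply.
rewrite (_ : [set _ | _] = set_val @` (f @^-1` W)).
  rewrite openE => _ [w fw <-]; apply: nbhs_set_val => //.
  exact: open_nbhs_nbhs.
apply/seteqP; split => [x /= [/andP[ux0 ux1] [y Vy xy]]|_ [w [h0 [y [t [Vy fw]]]] <-]].
  have /xU[w wx] := u1 _ ux1; exists w => //; split; first by rewrite -uU wx.
  exists y, (cone_level (u x)); split => //.
  by apply: (can_inj gK); apply: val_inj; rewrite fK; exact: etrans wx xy.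
split; first by have := ub w; rewrite uU; lra.
exists y => //; rewrite uU fw lift_heightE /cone_ray cone_level_height /=.
by rewrite -fw fK.
Qed.
End Extract.
End ConeChart.

(** * Local mobility *)

Lemma dependent_choice_nat (T : Type) (P : nat -> T -> Prop)
    (Q : nat -> T -> T -> Prop) (t0 : T) : P 0%N t0 ->
  (forall n t, P n t -> exists t', P n.+1 t' /\ Q n t t') ->
  exists f : nat -> T, f 0%N = t0 /\ forall n, P n (f n) /\ Q n (f n) (f n.+1).
Proof.
move=> P0 step.
have /choice[g gH] : forall a : nat * T, exists t', P a.1 a.2 ->
    P a.1.+1 t' /\ Q a.1 a.2 t'.
  move=> [n t]; have [/step[t' ?]|nP] := pselect (P n t); first by exists t'.
  by exists t => /nP.
pose f := fix f n := if n is m.+1 then g (m, f m) else t0.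
have Pf n : P n (f n) by elim: n => // n IH; exact: (gH (n, f n) IH).1.
by exists f; split => // n; split => //; exact: (gH (n, f n) (Pf n)).2.
Qed.

Section Effros.
Variables (R : realType) (X : metricType R).
Local Notation dist := (@mdist R X).

Definition locally_compact_metric := forall x : X, exists2 r : R, 0 < r &
  exists2 C : set X, compact C & [set y | dist x y < r] `<=` C.

Lemma compact_cauchy_limit (C : set X) (x_ : nat -> X) (N : nat) : compact C ->
  (forall n, (N <= n)%N -> C (x_ n)) ->
  (forall e : R, 0 < e -> exists M, forall n, (M <= n)%N -> dist (x_ M) (x_ n) < e) ->
  exists z : X, x_ n @[n --> \oo] --> z.
Proof.
move=> cC xC xcauchy.
have [|z [Cz clz]] := cC (x_ @ \oo) _.
  by exists N => // n; exact: xC.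
exists z; apply/metric_cvgP => e e0.
have [M MH] := xcauchy (e / 4) ltac:(lra); exists M => n Mn.
have [||y [[m /= Mm my] zy]] := clz [set y | exists2 m, (M <= m)%N & x_ m = y] [set y | dist z y < e / 4].
- by exists M => // m Mm; exists m.
- by apply: open_nbhs_nbhs; split; [exact: open_mball|rewrite /= mdistxx; lra].
have d1 := MH _ Mn; have d2 := MH _ Mm; rewrite -my /= in zy.
have := metric_triangle (x_ n) (x_ M) z; have := metric_triangle (x_ M) (x_ m) z.
by rewrite (metric_sym (x_ n) (x_ M)) (metric_sym (x_ m) z); lra.
Qed.

Lemma inv_nat_lt (e : R) : 0 < e -> exists n : nat, n.+1%:R^-1 < e.
Proof.
move=> e0; have [n _ H] := near_infty_natSinv_lt (PosNum e0).
by exists n; apply: H => /=.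
Qed.

Lemma closed_mball (x : X) (e : R) : closed [set y | dist x y <= e].
Proof.
rewrite (_ : [set _ | _] = ~` [set y | e < dist x y]); last first.
  by apply/seteqP; split => y /=; rewrite leNgt => /negP.
apply: open_closedC; rewrite openE => y /= xy; apply/metric_nbhsP.
exists (dist x y - e); first by lra.
move=> z yz /=; have := metric_triangle x z y; rewrite (metric_sym z y); lra.
Qed.

(** Closed balls are chosen inside one compact set, each avoiding one more [F n]. *)
Lemma baire_locally_compact (F : nat -> set X) (x0 : X) : locally_compact_metric ->
  (forall n, closed (F n)) -> (forall n, (F n)^° = set0) ->
  exists x, forall n, ~ F n x.
Proof.
move=> lc cF iF.
have [r0 r00 [C cC rC]] := lc x0.
pose P (n : nat) (s : X * R) := 0 < s.2 /\ [set y | dist s.1 y < s.2] `<=` C.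
pose Q (n : nat) (s t : X * R) := t.2 <= n.+1%:R^-1 /\
  [set y | dist t.1 y <= t.2] `<=` [set y | dist s.1 y < s.2] `\` F n.
have [||s [s0 sH]] := @dependent_choice_nat _ P Q (x0, r0).
- by split.
- move=> n [x r] [/= r1 rC'].
  have [y [/= xy nFy]] : exists y, dist x y < r /\ ~ F n y.
    apply: contrapT => H; have : (F n)^° x.
      apply/metric_nbhsP; exists r => // y xy; apply: contrapT => nF.
      by apply: H; exists y.
    by rewrite iF.
  have : nbhs y ([set z | dist x z < r] `&` ~` F n).
    apply: open_nbhs_nbhs; split => //.
    by apply: openI; [exact: open_mball|exact: closed_openC].
  move=> /metric_nbhsP[d d0 dH].
  pose d' := Num.min (d / 2) n.+1%:R^-1.
  have d'0 : 0 < d' by rewrite lt_min invr_gt0 ltr0Sn andbT; lra.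
  have d'd : d' <= d / 2 by rewrite ge_min lexx.
  exists (y, d'); split; split => //=.
  + by move=> z /= yz; apply: rC'; have [] := dH z ltac:(lra).
  + by rewrite ge_min lexx orbT.
  + by move=> z /= yz; apply: dH => /=; lra.
have sub m n y : (n <= m)%N -> dist (s m).1 y < (s m).2 -> dist (s n).1 y < (s n).2.
  move/subnK <-; elim: (m - n)%N => // k IH; rewrite addSn => H; apply: IH.
  have [_ [_ H2]] := sH (k + n)%N; have [] // := H2 y; exact: ltW.
have sc m : dist (s m).1 (s m).1 < (s m).2 by rewrite mdistxx; have [[]] := sH m.
have [||z zH] := @compact_cauchy_limit C (fun n => (s n).1) 0 cC.
- by move=> n _; have [[_ H] _] := sH n; apply: H; exact: sc.
- move=> e /inv_nat_lt[n ne]; exists n.+1 => m nm.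
  have [_ [sn _]] := sH n.
  exact: lt_le_trans (sub m n.+1 (s m).1 nm (sc m)) (le_trans sn (ltW ne)).
have zs n : dist (s n).1 z <= (s n).2.
  apply: (@closed_cvg _ _ _ _ _ [set y | dist (s n).1 y <= (s n).2]
    (@closed_mball _ _) _ z zH).
  by exists n => // m nm /=; apply: ltW; exact: sub nm (sc m).
by exists z => n; have [_ [_ H]] := sH n; have [] := H z (zs n.+1).
Qed.

Definition basis_family (I : choiceType) (B : I -> set X) :=
  (forall i, open (B i)) /\
  forall (x : X) (N : set X), open N -> N x -> exists2 i, B i x & B i `<=` N.

Lemma separable_basis : separable_space X ->
  exists B : nat * nat -> set X, basis_family B.
Proof.
move=> [D [/countable_injP[j jinj] dD]].
exists (fun im => \bigcup_(x in D `&` [set x | j x = im.1]) [set y | dist x y < im.2.+1%:R^-1]).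
split; first by move=> i; apply: bigcup_open => x _; exact: open_mball.
move=> x N oN Nx.
have /metric_nbhsP[e e0 eN] := open_nbhs_nbhs (conj oN Nx).
have [m me] : exists m : nat, m.+1%:R^-1 < e / 2 by apply: inv_nat_lt; lra.
have [||y [xy Dy]] := dD [set y | dist x y < m.+1%:R^-1].
- by exists x; rewrite /= mdistxx invr_gt0 ltr0Sn.
- exact: open_mball.
exists (j y, m); first by exists y => //=; rewrite metric_sym.
move=> z [y' [Dy' /= jy'] /= y'z]; apply: eN.
have {}jy' : y' = y by apply: jinj => //; exact: mem_set.
move: y'z; rewrite jy' => yz; apply: le_lt_trans (metric_triangle x y z) _.
by rewrite (splitr e); apply: ltrD; [exact: lt_trans xy me|exact: lt_trans yz me].
Qed.

Variables (I : countType) (B : I -> set X).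
Hypothesis bB : basis_family B.

Definition union_of (s : seq I) : set X := [set x | exists2 i, i \in s & B i x].

Lemma compact_union_of (K N : set X) : compact K -> open N -> K `<=` N ->
  exists s, K `<=` union_of s /\ union_of s `<=` N.
Proof.
move=> /compact_near_coveringP cK oN KN.
(* Finite lists of indices, directed by inclusion. *)
pose F := filter_from [set: seq I] (fun s0 => [set s : seq I | {subset s0 <= s}]).
have FF : Filter F.
  apply: filter_from_filter; first by exists [::].
  move=> s1 s2 _ _; exists (s1 ++ s2) => // s sub.
  by split => i si; apply: sub; rewrite mem_cat si ?orbT.
have [|s0 _ sH] := cK (seq I) F (fun (s : seq I) x => exists i, [/\ i \in s, B i `<=` N & B i x]) FF.
  move=> x /KN Nx; have [i Bi BN] := bB.2 x N oN Nx.
  exists (B i, [set s : seq I | i \in s]) => /=.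
    split; first by apply: open_nbhs_nbhs; split => //; exact: bB.1.
    by exists [:: i] => // s; apply; rewrite inE.
  by move=> [y s] [/= Biy si]; exists i.
exists [seq i <- s0 | `[< B i `<=` N >]]; split.
  move=> x Kx; have [i [si BN Bi]] := sH s0 (fun i => id) x Kx.
  by exists i => //; rewrite mem_filter si andbT; exact/asboolP.
by move=> x [i]; rewrite mem_filter => /andP[/asboolP BN _]; exact: BN.
Qed.

Variable Y : topologicalType.
Hypothesis charts : forall p, exists u k, @cone_chart R X Y p u k.

(** The code [s] separates three pairs of consecutive balls around [q].  Two points
with a common code have interleaving balls, and sevenths leave room for the six
heights needed by [chart_swindle]. *)
Definition coded (N : set X) (q : X) (s : seq I * seq I * seq I) :=
  exists u k, @cone_chart R X Y q u k /\ exists2 c, 0 < c < 1 &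
  [/\ [set x | u x <= c] `<=` N,
      [set x | u x <= c * (1 / 7)] `<=` union_of s.1.1 /\
        union_of s.1.1 `<=` [set x | u x <= c * (2 / 7)],
      [set x | u x <= c * (3 / 7)] `<=` union_of s.1.2 /\
        union_of s.1.2 `<=` [set x | u x <= c * (4 / 7)] &
      [set x | u x <= c * (5 / 7)] `<=` union_of s.2 /\
        union_of s.2 `<=` [set x | u x <= c * (6 / 7)]].

Lemma coded_exists N q : open N -> N q -> exists s, coded N q s.
Proof.
move=> oN Nq; have [u [k C]] := charts q.
have [c /andP[c0 c1] cN] := chart_basis C oN Nq.
have H a b : a < b -> b < 1 ->
    exists s, [set x | u x <= a] `<=` union_of s /\ union_of s `<=` [set x | u x <= b].
  move=> ab b1.
  have [|||s [s1 s2]] := @compact_union_of [set x | u x <= a] [set x | u x < b].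
  - by apply: (chart_compact C); lra.
  - exact: open_lt_chart C _.
  - by move=> x /=; lra.
  by exists s; split => // x /s2 /=; exact: ltW.
have [s1 H1] := H (c * (1 / 7)) (c * (2 / 7)) ltac:(lra) ltac:(lra).
have [s2 H2] := H (c * (3 / 7)) (c * (4 / 7)) ltac:(lra) ltac:(lra).
have [s3 H3] := H (c * (5 / 7)) (c * (6 / 7)) ltac:(lra) ltac:(lra).
by exists (s1, s2, s3), u, k; split => //; exists c => //; rewrite c0.
Qed.

Lemma coded_moves N p q s : coded N p s -> coded N q s -> moves N p q.
Proof.
move=> [u [k [Cu [c /andP[c0 c1] [_ [u1 _] [_ u2] [u3 _]]]]]].
move=> [v [m [Cv [d /andP[d0 d1] [dN [_ v1] [v2 _] [_ v3]]]]]].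
apply: (@movesS _ [set x | v x <= d * (3 / 7)]).
  by move=> x /= vx; apply: dN => /=; lra.
apply: (@chart_swindle _ _ _ _ _ _ _ _ _ (c * (1 / 7)) (c * (4 / 7)) (c * (5 / 7))
  (d * (2 / 7)) (d * (3 / 7)) (d * (6 / 7)) Cu Cv); try lra.
- exact: subset_trans u1 v1.
- exact: subset_trans v2 u2.
- exact: subset_trans u3 v3.
Qed.

Lemma charts_locally_compact : locally_compact_metric.
Proof.
move=> x; have [u [k C]] := charts x.
have : nbhs x [set y | u y < 1 / 2].
  by apply: open_nbhs_nbhs; split; [exact: open_lt_chart C _|rewrite /= (chart_apex C); lra].
move=> /metric_nbhsP[r r0 rH]; exists r => //; exists [set y | u y <= 1 / 2].
  by apply: (chart_compact C); lra.
by move=> y /rH /=; exact: ltW.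
Qed.

Hypothesis homog : forall p q : X, exists h : auto X, h p = q.

(** For a fixed basic set and a fixed code the coded points are mutually
equivalent, and the closure of a set minus its interior is nowhere dense; there
are countably many such pairs.  Homogeneity transports a point outside all
these exceptional sets to [x]. *)
Lemma moves_almost_open (N : set X) x : open N -> N x ->
  (closure [set y | moves N x y])^° x.
Proof.
move=> oN Nx.
pose E i s := [set q | B i q /\ coded (B i) q s].
pose F n := if unpickle n is Some (i, s) then closure (E i s) `\` (closure (E i s))^° else set0.
have [||x0 x0F] := @baire_locally_compact F x charts_locally_compact.
- move=> n; rewrite /F; case: unpickle => [[i s]|]; last exact: closed0.
  rewrite setDE; apply: closedI; first exact: closed_closure.
  by apply: open_closedC; exact: open_interior.
- move=> n; rewrite /F; case: unpickle => [[i s]|]; last by rewrite interior0.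
  rewrite -subset0 => y yi; have := interior_subset yi => -[_]; apply.
  by apply: interiorS yi => z [].
have good i : B i x0 -> (closure [set y | moves (B i) x0 y])^° x0.
  move=> Bi; have [s si] := coded_exists (bB.1 i) Bi.
  have := x0F (pickle (i, s)); rewrite /F pickleK => nF.
  have : (closure (E i s))^° x0.
    by apply: contrapT => H; apply: nF; split => //; apply: subset_closure.
  apply: interiorS; apply: closure_subset => q [_ qs].
  exact: coded_moves si qs.
have [h hx] := homog x0 x.
have oN' : open (h @^-1` N) by exact: open_preimage_auto.
have [|i Bi BN] := bB.2 x0 _ oN'; first by rewrite /= hx.
have : nbhs x (bw h @^-1` (closure [set y | moves (B i) x0 y])^°).
  apply: open_nbhs_nbhs; split.
    by apply: (open_preimage_auto (auto_inv h)); exact: open_interior.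
  by rewrite /= -hx fwK; exact: good.
apply: filterS => z /= /interior_subset zc A zA.
have : nbhs (bw h z) (h @^-1` A).
  by move: zA; rewrite -{1}(bwK h z); exact: (@fw_cont _ h).
move=> /zc[y [/= my Ay]]; exists (h y); split => //=.
rewrite -hx; apply: movesS (moves_conj h my) => w /= /BN /=.
by rewrite bwK.
Qed.

(** A support around [h z] that is small both in itself and when pulled back by
[h]. *)
Lemma small_ball (h : auto X) (z : X) (N : set X) (e : R) : open N -> N (h z) ->
  0 < e -> exists2 r, 0 < r <= e & [set w | dist (h z) w < r] `<=` N /\
    forall w, dist (h z) (h w) < r -> dist z w < e.
Proof.
move=> oN Nz e0.
have /metric_nbhsP[r1 r10 r1N] := open_nbhs_nbhs (conj oN Nz).
have [r2 r20 r2H] := (metric_continuousP _).1 (@bw_cont _ h) (h z) e e0.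
exists (Num.min r1 (Num.min r2 e)).
  by rewrite !lt_min !ge_min lexx !orbT r10 r20 e0.
split => w /=; rewrite !lt_min => /and3P[w1 w2 w3]; first exact: r1N.
by have := r2H _ w2; rewrite !fwK.
Qed.

(** Two sequences [h] and [k] are built with [h n x] and [k n y] in a common
support [V n]; each can be moved next to the other because, by
[moves_almost_open], each lies in the interior of the closure of the class of
the other. *)
Lemma moves_nbhs (N : set X) x : open N -> N x -> nbhs x [set y | moves N x y].
Proof.
move=> oN Nx.
have [r r0 [C cC rC]] := charts_locally_compact x.
pose N0 := N `&` [set y | dist x y < r].
have oN0 : open N0 by apply: openI => //; exact: open_mball.
have N0x : N0 x by split => //=; rewrite mdistxx.
have : nbhs x (N0 `&` (closure [set y | moves N0 x y])^°).
  apply: filterI; first exact: open_nbhs_nbhs.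
  by apply: open_nbhs_nbhs; split; [exact: open_interior|exact: moves_almost_open].
apply: filterS => y [N0y xy].
apply: (@movesS _ N0); first by move=> z [].
(* The last clause is what lets [k y] be approached from [h x] within [V]; the
change from [s] to [t] happens inside [V], and all of [V'] and its two
preimages are small. *)
pose P (n : nat) (s : auto X * auto X * set X) := let: (h, k, V) := s in
  [/\ open V, V `<=` N0, supported h N0 /\ supported k N0, V (h x) /\ V (k y) &
     (closure [set z | moves V (h x) z])^° (k y)].
pose Q (n : nat) (s t : auto X * auto X * set X) :=
  let: (h, k, V) := s in let: (h', k', V') := t in
  [/\ V' `<=` V, forall w, ~ V (h w) -> h' w = h w, forall w, ~ V (k w) -> k' w = k w &
   forall a b, [\/ V' a /\ V' b, V' (h' a) /\ V' (h' b) | V' (k' a) /\ V' (k' b)] ->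
     dist a b < n.+1%:R^-1].
have [||s [s0 sH]] := @dependent_choice_nat _ P Q (auto_id X, auto_id X, N0).
- by split.
- move=> n [[h k] V] [oV VN0 [sh sk] [Vhx Vky] hxky].
  pose e : R := n.+1%:R^-1 / 2.
  have e0 : 0 < e by apply: divr_gt0 => //; rewrite invr_gt0.
  have ee : n.+1%:R^-1 = e + e by rewrite /e -splitr.
  have [r1 /andP[r10 r1e] [r1V r1k]] := small_ball oV Vky e0.
  pose V1 := [set w | dist (k y) w < r1].
  have oV1 : open V1 by exact: open_mball.
  have V1ky : V1 (k y) by rewrite /V1 /= mdistxx.
  have A1 := moves_almost_open oV1 V1ky.
  have [x' [[f [sf fx']] [V1x' x'i]]] : exists x', moves V (h x) x' /\
      (V1 `&` (closure [set z | moves V1 (k y) z])^°) x'.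
    apply: (interior_subset hxky); apply: filterI; first exact: open_nbhs_nbhs.
    by apply: open_nbhs_nbhs; split => //; exact: open_interior.
  pose h' := auto_comp f h.
  have h'x : h' x = x' by [].
  have [|r2 /andP[r20 r2e] [r2V r2h]] := @small_ball h' x V1 e oV1 _ e0.
    by rewrite h'x.
  rewrite h'x in r2V r2h.
  pose V2 := [set w | dist x' w < r2].
  have oV2 : open V2 by exact: open_mball.
  have V2x' : V2 x' by rewrite /V2 /= mdistxx.
  have A2 := moves_almost_open oV2 V2x'.
  have [y' [[g [sg gy']] [V2y' y'i]]] : exists y', moves V1 (k y) y' /\
      (V2 `&` (closure [set z | moves V2 x' z])^°) y'.
    apply: (interior_subset x'i); apply: filterI; first exact: open_nbhs_nbhs.
    by apply: open_nbhs_nbhs; split => //; exact: open_interior.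
  have supS (j : auto X) M : supported j M -> M `<=` N0 -> supported j N0.
    by move=> sj MN w nw; apply: sj => /MN.
  have V1N0 : V1 `<=` N0 by move=> w /r1V/VN0.
  exists (h', auto_comp g k, V2); split; split => //=.
  + by move=> w /r2V/V1N0.
  + split => w nw /=; first by rewrite sh// (supS f V).
    by rewrite sk// (supS g V1).
  + by rewrite fx' gy'; split.
  + by rewrite fx' gy'.
  + by move=> w /r2V/r1V.
  + by move=> w nV; rewrite (sf _ nV).
  + by move=> w nV; rewrite sg// => /r1V.
  + have hlf c a b : dist c a < e -> dist c b < e -> dist a b < n.+1%:R^-1.
      by rewrite ee; have := metric_triangle a c b; rewrite (metric_sym a c); lra.
    move=> a b [[/r2V Va /r2V Vb]|[Va Vb]|[/r2V Va /r2V Vb]].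
    * by apply: (hlf (k y)); [move: Va|move: Vb]; rewrite /V1 /=; lra.
    * by apply: (hlf x); apply: r2h.
    * have gV w : V1 (g w) -> V1 w.
        by move=> Vg; rewrite -(fwK g w); apply: (@supported_stable _ (auto_inv g));
          [exact: supported_bw|].
      by apply: (hlf y); apply: r1k; apply: gV.
pose h n := (s n).1.1; pose k n := (s n).1.2; pose V n := (s n).2.
have sP n : P n (h n, k n, V n) by have [] := sH n; rewrite /h /k /V; case: (s n) => [[]].
have sQ n : Q n (h n, k n, V n) (h n.+1, k n.+1, V n.+1).
  by have [] := sH n; rewrite /h /k /V; case: (s n) => [[? ?] ?]; case: (s n.+1) => [[]].
have Vdec n : V n.+1 `<=` V n by have [] := sQ n.
have Vle m n : (n <= m)%N -> V m `<=` V n.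
  by move/subnK <-; elim: (m - n)%N => // i IH z /Vdec/IH.
have Vh n : V n (h n x) by have [_ _ _ []] := sP n.
have Vk n : V n (k n y) by have [_ _ _ []] := sP n.
have small e : 0 < e -> exists n, forall a b, [\/ V n a /\ V n b, V n (h n a) /\ V n (h n b) |
    V n (k n a) /\ V n (k n b)] -> dist a b < e.
  move=> /inv_nat_lt[n ne]; exists n.+1 => a b H.
  by have [_ _ _ /(_ a b H) ab] := sQ n; exact: lt_trans ab ne.
have sV : shrinking V.
  by move=> e /small[n nH]; exists n => a b Va Vb; apply: nH; constructor 1.
have [||z hz] := @compact_cauchy_limit C (fun n => h n x) 0 cC.
- move=> n _; apply: rC; have [_ VN _ [Vx _] _] := sP n.
  by have [] := VN _ Vx.
- move=> e /sV[n nH]; exists n => m nm; apply: nH => //.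
  exact: Vle nm _ (Vh m).
have kz : k n y @[n --> \oo] --> z.
  apply/metric_cvgP => e e0; have [n nH] := sV (e / 2) ltac:(lra).
  have [M MH] := (metric_cvgP _ _).1 hz (e / 2) ltac:(lra).
  exists (maxn n M) => m; rewrite geq_max => /andP[nm Mm].
  have d1 := nH _ _ (Vle m n nm _ (Vk m)) (Vle m n nm _ (Vh m)).
  have d2 := MH m Mm; have := metric_triangle (k m y) (h m x) z; lra.
have [n w||f [fx fl]] := @nested_limit _ _ h V x z Vdec _ Vh sV _ hz.
- by have [_ H _ _] := sQ n; exact: H.
- by move=> e /small[n nH]; exists n => a b Va Vb; apply: nH; constructor 2.
have [n w||g [gy gl]] := @nested_limit _ _ k V y z Vdec _ Vk sV _ kz.
- by have [_ _ H _] := sQ n; exact: H.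
- by move=> e /small[n nH]; exists n => a b Va Vb; apply: nH; constructor 3.
apply: (@moves_trans _ _ _ z).
  exists f; split => // w nw; apply: fl; apply: (@cvg_eventually _ _ _ _ 0) => n _.
  by have [_ _ [sh _] _ _] := sP n; exact: sh.
apply: moves_sym; exists g; split => // w nw; apply: gl.
apply: (@cvg_eventually _ _ _ _ 0) => n _.
by have [_ _ [_ sk] _ _] := sP n; exact: sk.
Qed.

Lemma moves_open (N : set X) x : open N -> N x -> open [set y | moves N x y].
Proof.
move=> oN Nx; rewrite openE => y /= xy.
apply: filterS (moves_nbhs oN (moves_stable xy Nx)) => z /=.
exact: moves_trans.
Qed.

End Effros.

(** * Punctured cones and connectedness *)

Section Connectedness.
Variables (R : realType) (X : metricType R).

Lemma connected_split (T : topologicalType) (C A A' : set T) : connected C ->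
  open A -> open A' -> A `&` A' = set0 -> C `<=` A `|` A' -> C `<=` A \/ C `<=` A'.
Proof.
move=> cC oA oA' AA' CAA'.
have [[x [Cx Ax]]|nA] := pselect ((C `&` A) !=set0); last first.
  right => x Cx; have [Ax|//] := CAA' x Cx.
  by exfalso; apply: nA; exists x.
left; rewrite -(cC (C `&` A)); first by move=> y [].
- by exists x.
- by exists A.
exists (~` A'); first exact: open_closedC.
apply/seteqP; split => y [Cy Ay]; split => //.
  by move=> A'y; have : (A `&` A') y by []; rewrite AA'.
by have [|] := CAA' y Cy.
Qed.

Lemma not_connected_clopen (T : topologicalType) : ~ connected [set: T] ->
  exists B : set T, [/\ open B, open (~` B), B !=set0 & (~` B) !=set0].
Proof.
move=> nC; apply: contrapT => H; apply: nC => B B0 [C oC BC] [D cD BD].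
apply/seteqP; split => // x _; apply: contrapT => nBx; apply: H; exists B.
split => //; last by exists x.
  by rewrite BC setTI.
by rewrite BD setTI; exact: closed_openC.
Qed.

Section Ray.
Variables (Y : topologicalType) (p : X) (u : X -> R) (k : Y -> R -> X).
Hypothesis C : cone_chart p u k.

Lemma chart_ray_cont y s : 0 < s < 1 -> {for s, continuous (k y)}.
Proof.
move=> s01.
have c1 : y @[t --> s] --> y by exact: cvg_cst.
have c2 : t @[t --> s] --> s by exact: cvg_id.
by move=> A /(chart_ray_continuous C s01)/(cvg_pair c1 c2).
Qed.

Lemma chart_fiber_cont y s : 0 < s < 1 -> {for y, continuous (k^~ s)}.
Proof.
move=> s01.
have c1 : z @[z --> y] --> y by exact: cvg_id.
have c2 : s @[z --> y] --> s by exact: cvg_cst.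
by move=> A /(chart_ray_continuous C s01)/(cvg_pair c1 c2).
Qed.

Lemma chart_segment_connected y a b : 0 <= a -> b <= 1 ->
  connected (k y @` `]a, b[%classic).
Proof.
move=> a0 b1; apply: connected_continuous_connected.
  by apply/connected_intervalP; exact: interval_is_interval.
apply: continuous_in_subspaceT => s; rewrite inE /= in_itv /= => s01.
by apply: chart_ray_cont; lra.
Qed.

Lemma chart_punctured_connected c : connected [set: Y] -> 0 < c -> c <= 1 ->
  connected [set x | 0 < u x < c].
Proof.
move=> cY c0 c1.
have c2 : 0 < c / 2 < 1 by lra.
(* One sphere together with one ray; the union over all [y] is the whole set. *)
pose A y := k^~ (c / 2) @` [set: Y] `|` k y @` `]0, c[%classic.
have AE : [set x | 0 < u x < c] = \bigcup_(y in [set: Y]) A y.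
  apply/seteqP; split => [x /= xc|x [y _ [[y' _ <-]|[s /= + <-]]]].
  - have [|y xy] := chart_surj C (x := x); first by lra.
    by exists y => //; right; exists (u x) => //; rewrite /= in_itv.
  - by rewrite /= (chart_height C)//; lra.
  - by rewrite in_itv /= => s0; rewrite (chart_height C); lra.
rewrite AE.
have [[y0 _]|Y0] := pselect ([set: Y] !=set0); last first.
  suff -> : \bigcup_(y in [set: Y]) A y = set0 by exact: connected0.
  by rewrite -subset0 => x [y _ _]; apply: Y0; exists y.
apply: bigcup_connected.
  by exists (k y0 (c / 2)) => y _; left; exists y0.
move=> y _; apply: connectedU.
- exists (k y (c / 2)); split; first by exists y.
  by exists (c / 2) => //; rewrite /= in_itv /=; lra.
- apply: connected_continuous_connected => //.
  by apply: continuous_in_subspaceT => z _; exact: chart_fiber_cont.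
- by apply: chart_segment_connected; lra.
Qed.

(** A splitting of [N] minus [p] would extend to a splitting of [N], because a
small punctured cone around [p] is connected and lies on one side. *)
Lemma connected_punctured (N : set X) : connected [set: Y] -> open N ->
  connected N -> connected (N `\ p).
Proof.
move=> cY oN cN.
have [Np|nNp] := pselect (N p); last first.
  suff -> : N `\ p = N by [].
  by apply/seteqP; split => [x []|x Nx] //; split => // xp; apply: nNp; rewrite -xp.
have [c /andP[c0 c1] cN'] := chart_basis C oN Np.
pose W := [set x | 0 < u x < c].
have cW : connected W by apply: chart_punctured_connected => //; exact: ltW.
have xp x : x <> p -> 0 < u x.
  move=> nxp; rewrite lt_neqAle (chart_ge0 C) andbT; apply/eqP => ux.
  by apply: nxp; apply: (chart_eq0 C).
have px x : 0 < u x -> x <> p by move=> ux E; move: ux; rewrite E (chart_apex C) ltxx.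
have cp : closed [set p].
  exact: (accessible_closed_set1 (hausdorff_accessible (@metric_hausdorff _ X))).
move=> B [b Bb] [G oG BG] [D cD BD].
have oB : open B.
  rewrite BG setDE; apply: openI => //; apply: openI => //; exact: closed_openC.
have oB' : open ((N `\ p) `\` B).
  rewrite (_ : _ `\` B = (N `\ p) `&` ~` D).
    by rewrite setDE; apply: openI; [apply: openI => //|]; exact: closed_openC.
  apply/seteqP; split => x [Nx]; rewrite BD => H; split => //.
    by move=> Dx; apply: H.
  by move=> [].
have WN : W `<=` B `|` ((N `\ p) `\` B).
  move=> x /andP[ux0 uxc]; have [Bx|nB] := pselect (B x); [by left|right].
  by split => //; split; [exact/cN'/ltW|exact: px].
have BN : B `<=` N `\ p by rewrite BG => x [].
have oc : open [set x | u x < c] by exact: open_lt_chart C c.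
(* If the punctured cone lies in [P], then adding the apex to [P] keeps it open. *)
have join (P Q : set X) : open P -> open Q -> P `&` Q = set0 ->
    P `|` Q = N `\ p -> W `<=` P -> Q = set0.
  move=> oP oQ PQ PQN WP; apply: contrapT => /eqP/set0P[q Qq].
  have [|||NP|NQ] := @connected_split _ N (P `|` [set x | u x < c]) Q cN _ oQ.
  - exact: openU.
  - rewrite -subset0 => x [Px Qx]; suff : (P `&` Q) x by rewrite PQ.
    split => //; case: Px => // /= ux; apply: WP.
    have [_ /xp ux0] : (N `\ p) x by rewrite -PQN; right.
    by rewrite /W /= ux0.
  - move=> x Nx; have [->|nxp] := pselect (x = p).
      by left; right; rewrite /= (chart_apex C).
    have : (P `|` Q) x by rewrite PQN.
    by move=> [|]; [left; left|right].
  - have [Nq /xp uq0] : (N `\ p) q by rewrite -PQN; right.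
    have [Pq|/= uq] := NP q Nq; first by have : (P `&` Q) q by []; rewrite PQ.
    have : (P `&` Q) q by split => //; apply: WP; rewrite /W /= uq0.
    by rewrite PQ.
  - have : (N `\ p) p by rewrite -PQN; right; exact: NQ.
    by move=> [_ /(_ erefl)].
have BB' : B `&` ((N `\ p) `\` B) = set0 by rewrite setDE setICA setICr setI0.
have BUB' : B `|` ((N `\ p) `\` B) = N `\ p by rewrite setDUK.
have [WB|WB'] := connected_split cW oB oB' BB' WN.
  have E := join _ _ oB oB' BB' BUB' WB.
  by rewrite -BUB' E setU0.
have : B b by [].
by rewrite (join _ _ oB' oB _ _ WB')// 1?setIC// setUC.
Qed.

End Ray.
End Connectedness.

(** * Strong homogeneity and one-manifolds *)

Section StrongHomogeneity.
Variables (R : realType) (X : metricType R) (Y : topologicalType).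
Hypothesis charts : forall p, exists u k, @cone_chart R X Y p u k.
Hypothesis slh : forall (N : set X) x, open N -> N x -> open [set y | moves N x y].

(** The classes of [moves N] are open and partition [N]. *)
Lemma moves_connected (N : set X) x y : open N -> connected N -> N x -> N y ->
  moves N x y.
Proof.
move=> oN cN Nx Ny.
suff E : N `&` [set z | moves N x z] = N by move: Ny; rewrite -{1}E => -[].
apply: cN.
- by exists x; split => //; exact: moves_refl.
- by exists [set z | moves N x z] => //; exact: slh.
exists (~` \bigcup_(z in N `&` [set z | ~ moves N x z]) [set w | moves N z w]).
  by apply: open_closedC; apply: bigcup_open => z [Nz _]; exact: slh.
apply/seteqP; split => z [Nz /= H]; split => //.
  move=> [w [Nw nxw] /= wz]; apply: nxw; apply: moves_trans H _; exact: moves_sym.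
by apply: contrapT => nxz; apply: H; exists z => //; exact: moves_refl.
Qed.

Lemma connected_cofinite (s : seq X) : connected [set: Y] -> connected [set: X] ->
  open [set x | x \notin s] /\ connected [set x | x \notin s].
Proof.
move=> cY cX; elim: s => [|a s [oN cN]].
  suff -> : [set x : X | x \notin [::]] = setT by split => //; exact: openT.
  by apply/seteqP; split.
have E : [set x | x \notin a :: s] = [set x | x \notin s] `\ a.
  apply/seteqP; split => x /=.
    by rewrite inE negb_or => /andP[/eqP xa xs].
  by move=> [xs /eqP xa]; rewrite inE negb_or xa.
have [u [k C]] := charts a; rewrite E; split.
  rewrite setDE; apply: openI => //; apply: closed_openC.
  exact: (accessible_closed_set1 (hausdorff_accessible (@metric_hausdorff _ X))).
exact (connected_punctured C cY oN cN).
Qed.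

(** The points of [s] are corrected one at a time, by a homeomorphism supported
off the images already reached. *)
Lemma finite_extension (f : X -> X) (s : seq X) :
  connected [set: Y] -> connected [set: X] -> {in s &, injective f} ->
  exists h : auto X, {in s, h =1 f}.
Proof.
move=> cY cX; elim: s => [|a s IH] finj; first by exists (auto_id X).
have [h hf] : exists h : auto X, {in s, h =1 f}.
  by apply: IH => x y xs ys; apply: finj; rewrite inE ?xs ?ys orbT.
have [as_|nas] := boolP (a \in s).
  by exists h => x; rewrite inE => /orP[/eqP ->|]; exact: hf.
have [oN cN] := connected_cofinite (map f s) cY cX.
have [||g [gN ga]] := moves_connected oN cN (x := h a) (y := f a).
- apply/negP => /mapP[b bs hab]; move: nas; rewrite (_ : a = b) ?bs//.
  by apply: (@fw_inj _ h); rewrite hab hf.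
- apply/negP => /mapP[b bs hab]; move: nas; rewrite (_ : a = b) ?bs//.
  by apply: finj => //; rewrite inE ?eqxx ?bs ?orbT.
exists (auto_comp g h) => x; rewrite inE => /orP[/eqP ->|xs] //=.
rewrite gN hf//=; apply/negP; rewrite negbK.
exact: map_f.
Qed.

Lemma connected_link_strongly_homogeneous n :
  connected [set: Y] -> connected [set: X] -> strongly_homogeneous n X.
Proof.
move=> cY cX A B f An _ [_ finj _].
have /finite_seqP[s As] : finite_set A by exists n.
have [|h hf] := finite_extension (f := f) (s := s) cY cX.
  by move=> x y xs ys; apply: finj; rewrite inE As.
exists h; split; first exact: auto_homeomorphism.
by move=> x; rewrite As; exact: hf.
Qed.

Section DisconnectedLink.
Variable B : set Y.
Hypotheses (oB : open B) (oB' : open (~` B)) (B0 : B !=set0) (B'0 : (~` B) !=set0).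

(** The part of a punctured cone over [B], or over the complement of [B]. *)
Definition side (v : X -> R) (m : Y -> R -> X) (b : bool) : set X :=
  [set x | 0 < v x < 1 /\ exists2 y, (if b then B else ~` B) y & x = m y (v x)].

Section Sides.
Variables (q : X) (v : X -> R) (m : Y -> R -> X).
Hypothesis D : cone_chart q v m.

Lemma open_side b : open (side v m b).
Proof. by apply: (chart_box_open D); case: b. Qed.

Lemma side_disjoint : side v m true `&` side v m false = set0.
Proof.
rewrite -subset0 => x [[vx [y By xy]] [_ [y' By' xy']]]; apply: By'.
by rewrite (@chart_inj _ _ _ _ _ _ D y' y _ vx)// -xy.
Qed.

Lemma side_cover x : 0 < v x < 1 -> side v m true x \/ side v m false x.
Proof.
move=> vx; have [y xy] := chart_surj D vx.
by have [By|nBy] := pselect (B y); [left|right]; split => //; exists y.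
Qed.

Lemma side_closure b (N : set X) : open N -> N q -> (side v m b `&` N) !=set0.
Proof.
move=> oN Nq; have [c /andP[c0 c1] cN] := chart_basis D oN Nq.
have [y by_] : (if b then B else ~` B) !=set0 by case: b.
have vy : v (m y c) = c by rewrite (chart_height D) ?c0.
exists (m y c); split; last by apply: cN; rewrite /= vy.
by split; [rewrite vy c0|exists y => //; rewrite vy].
Qed.
End Sides.

(** The point [q] on the ray of [y0] is an apex whose punctured cone falls into two
open sides, both accumulating at [q].  A short segment of a ray near [y0] lies on
one side.  If rays on one side accumulated at [y0], the ray of [y0] would lie on
that side as well, so no rays on the other side could accumulate, and that side
would miss a neighborhood of [q].  Hence no other rays come near [y0]. *)
Lemma isolated_link_point p u k (y0 : Y) : @cone_chart R X Y p u k -> open [set y0].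
Proof.
move=> C; have h01 : 0 < (1 / 2 : R) < 1 by lra.
pose q := k y0 (1 / 2).
have uq : u q = 1 / 2 by exact: chart_height C _ _ h01.
have [v [m D]] := charts q.
have [ [V S] /= [nV nS] VS] : nbhs (y0, (1 / 2 : R)) ((fun z => k z.1 z.2) @^-1` [set x | v x < 1]).
  apply: (chart_ray_continuous C h01); apply: open_nbhs_nbhs; split.
    exact: open_lt_chart D 1.
  by rewrite /= -/q (chart_apex D).
have [e /andP[e0 e1] eS] : exists2 e : R, 0 < e <= 1 / 2 & forall s, `|s - 1 / 2| < e -> S s.
  move/nbhs_ballP : nS => [e /= e0 eS]; exists (Num.min e (1 / 2)).
    by rewrite lt_min ge_min lexx orbT e0/=; lra.
  by move=> s; rewrite lt_min => /andP[se _]; apply: eS; rewrite /ball /= distrC.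
pose seg y : set X := k y @` `]1 / 2 - e, 1 / 2 + e[%classic.
have inseg y s : 1 / 2 - e < s < 1 / 2 + e -> seg y (k y s).
  by move=> H; exists s => //; rewrite /= in_itv.
have vseg y x : V y -> seg y x -> x <> q -> 0 < v x < 1.
  move=> Vy [s]; rewrite /= in_itv /= => s01 <- nq.
  have v1 : v (k y s) < 1.
    by apply: (VS (y, s)); split => //; apply: eS; rewrite ltr_norml /=; lra.
  rewrite v1 andbT lt_neqAle (chart_ge0 D) andbT; apply/eqP => v0.
  by apply: nq; apply: (chart_eq0 D).
pose A := side v m.
pose acc b := forall W, nbhs y0 W -> exists y, [/\ W y, V y, y <> y0 & seg y `<=` A b].
have segA y : V y -> y <> y0 -> seg y `<=` A true \/ seg y `<=` A false.
  move=> Vy nyy0; apply: connected_split.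
  - by apply: (chart_segment_connected C); lra.
  - exact: open_side D _.
  - exact: open_side D _.
  - exact: side_disjoint D.
  - move=> x xs; apply: (side_cover D); apply: (vseg _ _ Vy xs).
    move=> xq; apply: nyy0; move: xs => [s]; rewrite /= in_itv /= => s01 sx.
    have s1 : 0 < s < 1 by lra.
    have us : s = 1 / 2 by move: uq; rewrite -xq -sx (chart_height C).
    by apply: (chart_inj C h01); rewrite -{1}us sx xq.
have disj b x : A b x -> A (~~ b) x -> False.
  have AA z : A true z -> A false z -> False.
    by move=> H1 H2; have : (A true `&` A false) z by []; rewrite [_ `&` _](side_disjoint D).
  by case: b => /= H1 H2; [exact: AA H1 H2|exact: AA H2 H1].
have V0 : V y0 by exact: nbhs_singleton.
have acc_seg b s : acc b -> 1 / 2 - e < s < 1 / 2 + e -> s != 1 / 2 -> A b (k y0 s).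
  move=> ab s01 ns.
  have s1 : 0 < s < 1 by lra.
  have vs : 0 < v (k y0 s) < 1.
    apply: (vseg y0) => //; first exact: inseg.
    by move=> /(congr1 u); rewrite (chart_height C)// uq => E; move: ns; rewrite E eqxx.
  have : A b (k y0 s) \/ A (~~ b) (k y0 s) by have := side_cover D vs; case: b {ab} => /=; tauto.
  move=> [//|nA]; exfalso.
  have : nbhs y0 (k^~ s @^-1` A (~~ b)).
    by apply: (chart_fiber_cont C s1); apply: open_nbhs_nbhs; split => //; exact: open_side D _.
  by move=> /ab[y [/= Ay Vy ny /(_ (k y s) (inseg _ _ s01)) Ay']]; exact: disj Ay' Ay.
have not_acc2 b : acc b -> acc (~~ b) -> False.
  move=> ab anb; have s01 : 1 / 2 - e < 1 / 2 + e / 2 < 1 / 2 + e by lra.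
  have ns : 1 / 2 + e / 2 != 1 / 2 by apply/eqP; lra.
  exact: disj (acc_seg _ _ ab s01 ns) (acc_seg _ _ anb s01 ns).
have not_acc1 b : ~ acc b.
  move=> ab; have := not_acc2 b ab; apply => W nW.
  apply: contrapT => H.
  have : nbhs y0 (W `&` V) by exact: filterI.
  rewrite nbhsE => -[V' [oV' V'y0] V'W].
  pose box := [set x | 1 / 2 - e < u x] `&` [set x | u x < 1 / 2 + e] `&`
    [set x | 0 < u x < 1 /\ exists2 y, V' y & x = k y (u x)].
  have obox : open box.
    apply: openI; first by apply: openI; [exact: open_gt_chart C _|exact: open_lt_chart C _].
    exact: chart_box_open C _ oV'.
  have boxq : box q.
    by split; [split => /=; lra|split; [rewrite uq|exists y0 => //; rewrite uq]].
  have [x [xA [[/= xl xr] [ux [y V'y xy]]]]] := side_closure D (~~ b) obox boxq.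
  have xseg : seg y x by rewrite xy; apply: inseg; rewrite xl.
  have nxq : x <> q.
    by move=> E; have [vx _] := xA; move: vx; rewrite E (chart_apex D) ltxx.
  have [Wy Vy] := V'W _ V'y.
  have [yy0|nyy0] := pselect (y = y0).
    apply: (disj b x) => //; rewrite xy yy0; apply: acc_seg => //; first by rewrite xl.
    by apply/eqP => E; apply: nxq; rewrite xy yy0 E.
  have [sA|sA] : seg y `<=` A b \/ seg y `<=` A (~~ b).
    by have := segA y Vy nyy0; case: b {ab H xA} => /=; tauto.
    exact: disj (sA _ xseg) xA.
  by apply: H; exists y.
have {not_acc1} no b : exists2 W, nbhs y0 W & forall y, W y -> V y -> y <> y0 -> ~ (seg y `<=` A b).
  apply: contrapT => H; apply: (not_acc1 b) => W nW; apply: contrapT => H2.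
  by apply: H; exists W => // y Wy Vy ny sA; apply: H2; exists y.
have [W1 nW1 H1] := no true; have [W2 nW2 H2] := no false.
rewrite openE => _ ->; have : nbhs y0 (V `&` (W1 `&` W2)) by do 2 apply: filterI => //.
apply: filterS => y [Vy [W1y W2y]] /=; apply: contrapT => ny.
by have [] := segA y Vy ny; [exact: H1|exact: H2].
Qed.

Definition logit (s : R) : R := ln (s / (1 - s)).
Definition sigmoid (r : R) : R := expR r / (1 + expR r).

Lemma sigmoid01 r : 0 < sigmoid r < 1.
Proof.
have e0 := expR_gt0 r.
by rewrite /sigmoid divr_gt0 ?ltr_pdivrMr; lra.
Qed.

Lemma logitK s : 0 < s < 1 -> sigmoid (logit s) = s.
Proof.
move=> s01; rewrite /sigmoid /logit lnK; last by rewrite posrE divr_gt0; lra.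
by field; apply/andP; split; apply/eqP; lra.
Qed.

Lemma sigmoidK r : logit (sigmoid r) = r.
Proof.
have e0 := expR_gt0 r.
rewrite /sigmoid /logit (_ : _ / (1 - _) = expR r) ?expRK//.
by field; apply/andP; split; apply/eqP; lra.
Qed.

Lemma logit_continuous s : 0 < s < 1 -> {for s, continuous logit}.
Proof.
move=> s01; apply: (@continuous_comp _ _ _ (fun s : R => s / (1 - s)) (@ln R)).
  apply: cvgM; first exact: cvg_id.
  apply: cvgV; first by apply/eqP; lra.
  by apply: cvgB; [exact: cvg_cst|exact: cvg_id].
by apply: continuous_ln; apply: divr_gt0; lra.
Qed.

Lemma sigmoid_continuous : continuous sigmoid.
Proof.
move=> r; apply: cvgM; first exact: continuous_expR.
apply: cvgV; first by apply/eqP; have := expR_gt0 r; lra.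
by apply: cvgD; [exact: cvg_cst|exact: continuous_expR].
Qed.

(** An open ray is parametrized by its height in the unit interval, which the
logit maps onto the line. *)
Lemma isolated_ray_line p u k (y0 : Y) : @cone_chart R X Y p u k -> open [set y0] ->
  exists U : set X, [/\ open U, U (k y0 (1 / 2)) & homeomorphic U R].
Proof.
move=> C oy0.
pose U := [set x | 0 < u x < 1 /\ exists2 y, [set y0] y & x = k y (u x)].
have Uk s : 0 < s < 1 -> U (k y0 s).
  by move=> s01; rewrite /U /= (chart_height C)//; split => //; exists y0.
have Uu (w : U) : 0 < u (set_val w) < 1 /\ set_val w = k y0 (u (set_val w)).
  by have [uw [y /= -> xy]] := set_valP w.
exists U; split; [exact: chart_box_open C _ oy0|by apply: Uk; lra|].
pose f (w : U) := logit (u (set_val w)).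
pose g (r : R) : U := exist (fun x => x \in U) _ (mem_set (Uk _ (sigmoid01 r))).
have gv r : set_val (g r) = k y0 (sigmoid r) by [].
exists f; split.
  move=> w; apply: (@continuous_comp _ _ _ (fun w : U => u (set_val w)) logit).
    apply: (@continuous_comp _ _ _ (fun w : U => set_val w) u); last exact: (chart_continuous C).
    exact: initial_continuous.
  by apply: logit_continuous; exact: (Uu w).1.
exists g; split.
- move=> w; apply: val_inj; rewrite -[LHS]/(set_val (g (f w))) gv /f.
  by rewrite logitK; [exact/esym/(Uu w).2|exact: (Uu w).1].
- by move=> r; rewrite /f gv (chart_height C) ?sigmoidK//; exact: sigmoid01.
- move=> r; apply: cvg_set_type.
  apply: (@continuous_comp _ _ _ sigmoid (k y0)); first exact: sigmoid_continuous.
  by apply: (chart_ray_cont C); exact: sigmoid01.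
Qed.

End DisconnectedLink.

Lemma disconnected_link_one_manifold : 
  (forall p q : X, exists h : auto X, h p = q) -> @second_countable X ->
  ~ connected [set: Y] -> one_manifold R X.
Proof.
move=> homog sc /not_connected_clopen[B [oB oB' B0 B'0]].
split => //; first exact: metric_hausdorff.
move=> x; have [u [k C]] := charts x; have [y0 _] := B0.
have [h hx] := homog (k y0 (1 / 2)) x.
have C' := chart_auto h C.
rewrite -hx; apply: (isolated_ray_line C').
exact: isolated_link_point oB oB' B0 B'0 _ _ _ _ C'.
Qed.

End StrongHomogeneity.

(** * Countable dense homogeneity *)

Section CountableDense.
Variables (R : realType) (X : metricType R).
Local Notation dist := (@mdist R X).
Hypothesis lc : @locally_compact_metric R X.
Hypothesis slh : forall (N : set X) x, open N -> N x -> open [set y | moves N x y].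

Definition radii (x : X) : set R := [set r | 0 <= r <= 1 /\
  exists2 C : set X, compact C & [set y | dist x y < r] `<=` C].

(** The radius of local compactness: slightly smaller balls are contained in a
compact set. *)
Definition lcr (x : X) : R := sup (radii x).

Lemma radii_has_sup x : has_sup (radii x).
Proof.
split; last by exists 1 => r [/andP[]].
exists 0; split; first by rewrite lexx ler01.
exists set0; first exact: compact0.
by move=> y /=; have := mdist_ge0 x y; rewrite ltNge => ->.
Qed.

Lemma radii_le x r : radii x r -> r <= lcr x.
Proof. by move=> xr; apply: ub_le_sup => //; exact: (radii_has_sup x).2. Qed.

Lemma lcr_gt0 x : 0 < lcr x.
Proof.
have [r r0 [C cC rC]] := lc x.
apply: (@lt_le_trans _ _ (Num.min r 1)); first by rewrite lt_min r0 ltr01.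
apply: radii_le; split; first by rewrite le_min ge_min lexx orbT (ltW r0) ler01.
exists C => // y /= yr; apply: rC => /=; apply: lt_le_trans yr _.
by rewrite ge_min lexx.
Qed.

Lemma lcr_le1 x : lcr x <= 1.
Proof. by apply: ge_sup; [exact: (radii_has_sup x).1|move=> r [/andP[]]]. Qed.

Lemma lcr_lipschitz x y : lcr x <= lcr y + dist x y.
Proof.
apply: ge_sup; first exact: (radii_has_sup x).1.
move=> r [/andP[r0 r1] [C cC rC]].
have [rd|rd] := lerP r (dist x y); first by have := lcr_gt0 y; lra.
have : radii y (r - dist x y).
  split; first by have := mdist_ge0 x y; lra.
  exists C => // z /= yz; apply: rC => /=.
  by have := metric_triangle x y z; lra.
by move=> /radii_le; lra.
Qed.

Lemma lcr_compact x r : r < lcr x ->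
  exists2 C : set X, compact C & [set y | dist x y < r] `<=` C.
Proof.
move=> rx; have [|s [_ [C cC sC]] xs] := @sup_adherent _ _ (lcr x - r) _ (radii_has_sup x).
  lra.
exists C => // y /= yr; apply: sC => /=; rewrite -/(lcr x) in xs.
lra.
Qed.

(** Displacements are measured against [lcr] before moving, in source and in
target; this is symmetric under inversion. *)
Definition near_auto (e : R) (h h' : auto X) :=
  (forall x, dist (h x) (h' x) <= e * lcr (h x)) /\
  (forall y, dist (bw h y) (bw h' y) <= e * lcr (bw h y)).

Lemma near_auto_inv e h h' : near_auto e h h' -> near_auto e (auto_inv h) (auto_inv h').
Proof. by move=> [H1 H2]; split. Qed.

Lemma near_auto_refl e h : 0 <= e -> near_auto e h h.
Proof. by move=> e0; split => x; rewrite mdistxx mulr_ge0// ltW// lcr_gt0. Qed.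

Lemma near_auto_trans e h h1 h2 : 0 <= e <= 1 ->
  near_auto e h h1 -> near_auto e h1 h2 -> near_auto (3 * e) h h2.
Proof.
move=> e01 H1 H2.
have key a b c : dist a b <= e * lcr a -> dist b c <= e * lcr b ->
    dist a c <= 3 * e * lcr a.
  move=> ab bc; have := metric_triangle a b c.
  have := lcr_lipschitz b a; rewrite (metric_sym b a) => ba.
  have La := lcr_gt0 a.
  have : e * lcr b <= e * (lcr a + dist a b) by apply: ler_wpM2l => //; lra.
  have : e * dist a b <= e * lcr a.
    apply: ler_wpM2l; first by lra.
    apply: le_trans ab _; apply: ler_piMl; lra.
  lra.
split => x; first exact: key (H1.1 x) (H2.1 x).
exact: key (H1.2 x) (H2.2 x).
Qed.

Lemma push_into_dense (B F : set X) (h : auto X) (a : X) (e : R) :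
  dense B -> closed F -> ~ F (h a) -> 0 < e ->
  exists h' : auto X, [/\ near_auto e h h', B (h' a) &
    forall x, F (h x) -> h' x = h x].
Proof.
move=> dB cF nF e0.
(* A displacement of at most [rho / 2] near [h a], or near [a], is small compared
with [lcr], which is at least [3 * rho / 4] there. *)
pose rho := Num.min (lcr (h a)) (lcr a).
have rho0 : 0 < rho by rewrite lt_min !lcr_gt0.
have rho1 : rho <= lcr (h a) by rewrite ge_min lexx.
have rho2 : rho <= lcr a by rewrite ge_min lexx orbT.
pose d := Num.min e 1 * rho / 4.
have m0 : 0 < Num.min e 1 by rewrite lt_min e0 ltr01.
have d0 : 0 < d by rewrite divr_gt0// mulr_gt0.
have d1 : d <= rho / 4.
  rewrite ler_pM2r; last by lra.
  by apply: ler_piMl; [exact: ltW|rewrite ge_min lexx orbT].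
have d2 : d <= e * rho / 4.
  rewrite ler_pM2r; last by lra.
  by rewrite ler_pM2r// ge_min lexx.
have [r /andP[r0 rd] [rF rh]] := small_ball (closed_openC cF) nF d0.
pose V := [set w | dist (h a) w < r].
have Va : V (h a) by rewrite /V /= mdistxx.
have oV : open V by exact: open_mball.
have [||b [[f [sf fb]] Bb]] := dB [set y | moves V (h a) y].
- by exists (h a); exact: moves_refl.
- exact: slh.
have key c w w' : rho <= lcr c -> dist c w <= d -> dist c w' <= d ->
    dist w w' <= e * lcr w.
  move=> rc cw cw'; have := metric_triangle w c w'; have := lcr_lipschitz c w.
  rewrite (metric_sym w c) => H1 H2.
  have : e * (rho * 3 / 4) <= e * lcr w by apply: ler_wpM2l; lra.
  have : 0 <= e * rho by apply: mulr_ge0; lra.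
  lra.
have stay x : dist x x <= e * lcr x.
  by rewrite mdistxx mulr_ge0// ltW// lcr_gt0.
exists (auto_comp f h); split.
- split => [x|y] /=.
    have [Vx|nV] := pselect (V (h x)); last by rewrite sf.
    have := supported_stable sf Vx; rewrite /V /= in Vx * => Vfx.
    by apply: (key (h a)) => //; lra.
  have [Vy|nV] := pselect (V y); last by rewrite (supported_bw sf).
  have Vfy := supported_stable (f := auto_inv f) (supported_bw sf) Vy.
  apply: (key a) => //; apply: ltW; apply: rh; rewrite bwK; last exact: Vfy.
  exact: Vy.
- by rewrite /= fb.
- by move=> x Fx /=; rewrite sf// => /rF.
Qed.

Section BackAndForth.
Implicit Types (A B : set X) (i j : X -> nat).

(** Among the first [n] points of [A] and the first [m] points of [B], as numbered
by [i] and [j], all are matched with points of the other set. *)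
Definition matched A B i j (n m : nat) (h : auto X) :=
  (forall a, A a -> (i a < n)%N -> B (h a)) /\
  (forall b, B b -> (j b < m)%N -> A (bw h b)).

Definition fixes A B i j (n m : nat) (h h' : auto X) :=
  (forall a, A a -> (i a < n)%N -> h' a = h a) /\
  (forall b, B b -> (j b < m)%N -> bw h' b = bw h b).

Lemma finite_initial A i n : {in A &, injective i} ->
  finite_set (A `&` [set a | (i a < n)%N]).
Proof.
move=> ii; set A' := _ `&` _.
have /inj_card_eq/eq_finite_set <- : {in A' &, injective i}.
  by move=> x y; rewrite !inE => -[Ax _] [Ay _]; apply: ii; rewrite inE.
by apply: sub_finite_set (finite_II n) => _ [a [_ an] <-].
Qed.

(** Points already matched, on either side, form a finite set that the new support
avoids; a point whose image lies in it is matched already. *)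
Lemma back_and_forth_half A B i j n m h e : dense B ->
  {in A &, injective i} -> {in B &, injective j} ->
  matched A B i j n m h -> 0 < e ->
  exists h', [/\ matched A B i j n.+1 m h', near_auto e h h' & fixes A B i j n m h h'].
Proof.
move=> dB ii jj [hA hB] e0.
have [[a [Aa ia nBa]]|H] := pselect (exists a, [/\ A a, i a = n & ~ B (h a)]); last first.
  exists h; split; [split => // a Aa|exact/near_auto_refl/ltW|by split].
  rewrite ltnS leq_eqVlt => /orP[/eqP ia|]; last exact: hA.
  by apply: contrapT => nB; apply: H; exists a.
pose F := h @` (A `&` [set a | (i a < n)%N]) `|` (B `&` [set b | (j b < m)%N]).
have cF : closed F.
  have := hausdorff_accessible (@metric_hausdorff _ X).
  move=> /accessible_finite_set_closed; apply; rewrite finite_setU; split.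
    by apply: finite_image; exact: finite_initial.
  exact: finite_initial.
have nF : ~ F (h a).
  move=> [[a' [Aa' /= ia'] /fw_inj aa']|[Bha _]] //.
  by move: ia'; rewrite aa' ia ltnn.
have [h' [near' Bh' fix']] := push_into_dense dB cF nF e0.
have fA a' : A a' -> (i a' < n)%N -> h' a' = h a'.
  by move=> Aa' ia'; apply: fix'; left; exists a'.
have fB b : B b -> (j b < m)%N -> bw h' b = bw h b.
  move=> Bb jb; apply: (@fw_inj _ h'); rewrite bwK fix' bwK//.
  by right.
exists h'; split => //; split => [a' Aa'|b Bb jb]; last by rewrite fB//; exact: hB.
rewrite ltnS leq_eqVlt => /orP[/eqP ia'|ia']; last by rewrite fA//; exact: hA.
by rewrite (_ : a' = a)//; apply: ii; rewrite ?inE// ia' ia.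
Qed.

Lemma back_and_forth_step A B i j n h e : dense A -> dense B ->
  {in A &, injective i} -> {in B &, injective j} ->
  matched A B i j n n h -> 0 < e <= 1 ->
  exists h', matched A B i j n.+1 n.+1 h' /\
    (near_auto (3 * e) h h' /\ fixes A B i j n n h h').
Proof.
move=> dA dB ii jj mh /andP[e0 e1].
have [h1 [m1 near1 fix1]] := back_and_forth_half dB ii jj mh e0.
have m1' : matched B A j i n n.+1 (auto_inv h1) by case: m1.
have [h2 [m2 near2 fix2]] := back_and_forth_half dA jj ii m1' e0.
exists (auto_inv h2); split; first by case: m2.
split; last first.
  split => [a Aa ia|b Bb jb].
    by rewrite -fix1.1//; apply: fix2.2 => //; exact: ltnW.
  by rewrite -fix1.2//; exact: fix2.1.
apply: near_auto_trans near1 (near_auto_inv near2).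
by rewrite (ltW e0).
Qed.

End BackAndForth.

Lemma half_power_lt (e : R) : 0 < e -> exists n, (2^-1 : R) ^+ n.+1 < e.
Proof.
move=> e0; have half1 : `|2^-1 : R| < 1 by rewrite ger0_norm; lra.
have /cvgrPdist_lt/(_ e e0)[n _ nH] := cvg_expr half1.
exists n; have := nH n.+1 (leqnSn n); rewrite /= sub0r normrN ger0_norm//.
Qed.

(** The radius [lcr] is 1-Lipschitz, so it at most doubles along the sequence and
the displacements are dominated by a geometric series: the sequence stays in a
ball contained in a compact set. *)
Lemma controlled_sequence (w : nat -> X) :
  (forall n, dist (w n) (w n.+1) <= 2^-1 ^+ n.+3 * lcr (w n)) ->
  (forall n m, (n <= m)%N -> dist (w n) (w m) <= 2^-1 ^+ n.+1) /\
  exists l : X, w n @[n --> \oo] --> l.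
Proof.
move=> wS.
pose p n : R := 2^-1 ^+ n.
have pS n : p n = 2 * p n.+1 by rewrite /p exprS mulrA divff ?mul1r.
have p0 n : 0 < p n by apply: exprn_gt0; rewrite invr_gt0.
have p1 n : p n <= 1 by apply: exprn_ile1; lra.
have H n k : dist (w n) (w (k + n)%N) <= (p n.+1 - p (k + n).+1) * lcr (w n).
  elim: k => [|k IH]; first by rewrite add0n mdistxx subrr mul0r.
  rewrite addSn; set m := (k + n)%N in IH *.
  have L0 := lcr_gt0 (w n).
  have d1 : dist (w n) (w m) <= lcr (w n).
    apply: le_trans IH _; apply: ler_piMl; first exact: ltW.
    by have := p1 n.+1; have := p0 m.+1; lra.
  have := lcr_lipschitz (w m) (w n); rewrite (metric_sym (w m)) => L2.
  have : p m.+3 * lcr (w m) <= p m.+3 * (2 * lcr (w n)).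
    by apply: ler_wpM2l; [exact: ltW|lra].
  have := metric_triangle (w n) (w m) (w m.+1); have := wS m; rewrite -/(p m.+3).
  move: IH; rewrite (pS m.+1) (pS m.+2); lra.
have H2 n m : (n <= m)%N -> dist (w n) (w m) <= p n.+1 * lcr (w n).
  move/subnK <-; apply: le_trans (H _ _) _.
  by apply: ler_wpM2r; [exact/ltW/lcr_gt0|have := p0 (m - n + n).+1; lra].
have H3 n m : (n <= m)%N -> dist (w n) (w m) <= p n.+1.
  move=> /H2 nm; apply: le_trans nm _; apply: ler_piMr; [exact: ltW|exact: lcr_le1].
split => //.
have L0 := lcr_gt0 (w 0%N).
have [C cC LC] : exists2 C : set X, compact C & [set y | dist (w 0%N) y < lcr (w 0%N) * (3 / 4)] `<=` C.
  by apply: lcr_compact; lra.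
apply: (@compact_cauchy_limit _ _ C w 0 cC).
  move=> n _; apply: LC => /=; have := H2 0%N n (leq0n n).
  by rewrite /p expr1; lra.
move=> e /half_power_lt[n ne].
by exists n => m nm; exact: le_lt_trans (H3 n m nm) ne.
Qed.

Lemma mobile_countable_dense_homogeneous : countable_dense_homogeneous X.
Proof.
move=> A B /countable_injP[i ii] dA /countable_injP[j jj] dB.
(* Each step consists of two moves, which together cost a factor 3. *)
pose e n : R := 2^-1 ^+ n.+3 / 3.
have e01 n : 0 < e n <= 1.
  have p1 : (2^-1 : R) ^+ n.+3 <= 1 by apply: exprn_ile1; lra.
  have p0 : 0 < (2^-1 : R) ^+ n.+3 by apply: exprn_gt0; rewrite invr_gt0.
  by rewrite /e; lra.
have [||h [h0 hH]] := @dependent_choice_nat _ (fun n => matched A B i j n n)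
  (fun n h h' => near_auto (3 * e n) h h' /\ fixes A B i j n n h h') (auto_id X).
- by split.
- by move=> n h mh; exact: back_and_forth_step.
have e3 n : 3 * e n = 2^-1 ^+ n.+3 by rewrite /e; field.
have hm n : matched A B i j n n (h n) by have [] := hH n.
have hn n : near_auto (2^-1 ^+ n.+3) (h n) (h n.+1) by have [_ []] := hH n; rewrite e3.
have hf n : fixes A B i j n n (h n) (h n.+1) by have [_ []] := hH n.
have cf x := controlled_sequence (fun n => (hn n).1 x).
have cb x := controlled_sequence (fun n => (hn n).2 x).
have [||||f fl] := @limit_auto _ _ h.
- move=> d /half_power_lt[n nd]; exists n => m nm x.
  by apply: le_lt_trans nd; have [H _] := cf x; exact: H.
- move=> d /half_power_lt[n nd]; exists n => m nm x.
  by apply: le_lt_trans nd; have [H _] := cb x; exact: H.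
- by move=> x; have [] := cf x.
- by move=> x; have [] := cb x.
have fA a n : A a -> (i a < n)%N -> f a = h n a.
  move=> Aa ian; apply: (metric_lim_unique (fl a)).
  apply: (@cvg_eventually _ _ _ _ n) => m; move/subnK <-.
  elim: (m - n)%N => // k IH; rewrite addSn -IH; apply: (hf _).1 => //.
  by apply: leq_trans ian _; rewrite leq_addl.
exists f; split; first exact: auto_homeomorphism.
apply/seteqP; split => [_ [a Aa <-]|b Bb].
  by rewrite (fA a (i a).+1)//; exact: (hm _).1.
pose n := (j b).+1; pose a := bw (h n) b.
have Aa : A a by apply: (hm n).2.
have ha m : (n <= m)%N -> h m a = b.
  move/subnK <-; elim: (m - n)%N => [|k IH]; first by rewrite add0n bwK.
  rewrite addSn; have E : bw (h (k + n).+1) b = a.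
    by rewrite (hf (k + n)%N).2//; [rewrite -[in LHS]IH fwK|rewrite /n addnS ltnS leq_addl].
  by rewrite -E bwK.
exists a => //; rewrite (fA a (maxn n (i a).+1))// ?leq_max ?ltnSn ?orbT//.
by apply: ha; rewrite leq_max leqnn.
Qed.

End CountableDense.

Lemma basis_second_countable (R : realType) (X : metricType R) (I : countType)
  (B : I -> set X) : basis_family B -> @second_countable X.
Proof.
move=> [oB bB]; exists (range B).
  by apply: (card_le_trans (card_image_le B _)); exact: countableP.
split; first by move=> _ [i _ <-].
move=> x N; rewrite nbhsE => -[V [oV Vx] VN].
have [i Bix BiV] := bB x V oV Vx.
exists (B i); first by split => //; exists i.
exact: subset_trans BiV VN.
Qed.

Lemma locally_conical_charts (R : realType) (X : metricType R) (x : X) :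
  homogeneous X -> locally_conical R X ->
  exists Y : topologicalType,
    forall p, exists u k, @cone_chart R X Y p u k.
Proof.
move=> hX /(_ x)[U [oU Ux [Y [cY [f [cf [g [fK gK cg]]]]]]]].
have [p [u C]] := open_cone_chart oU cY cf cg fK gK Ux.
exists Y => q; have [h0 [/homeomorphism_auto[h hE] hpq]] := hX p q.
by rewrite -hpq -hE; do 2 eexists; exact: chart_auto C.
Qed.

Lemma empty_strongly_homogeneous (X : topologicalType) n :
  ~ (exists x : X, True) -> strongly_homogeneous n X.
Proof.
move=> nX A B f _ _ _; exists id; split; last by move=> x; exfalso; apply: nX; exists x.
exact: (auto_homeomorphism (auto_id X)).
Qed.

Theorem mainTheorem1 :
  (forall (R : realType) (X : metricType R),
      separable_space X -> connected [set: X] ->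
      homogeneous X -> locally_conical R X -> ~ one_manifold R X ->
      forall n : nat, (2 <= n)%N -> strongly_homogeneous n X) /\
  (forall (R : realType) (X : metricType R),
      separable_space X -> homogeneous X -> locally_conical R X ->
      countable_dense_homogeneous X).
Proof.
have homog (X : topologicalType) : homogeneous X ->
    forall p q : X, exists h : auto X, h p = q.
  move=> hX p q; have [h0 [/homeomorphism_auto[h hE] hpq]] := hX p q.
  by exists h; rewrite hE.
split=> R X sX.
  move=> cX hX lX nX n _.
  have [[x _]|eX] := pselect (exists x : X, True); last exact: empty_strongly_homogeneous.
  have [Y charts] := locally_conical_charts x hX lX.
  have [B bB] := separable_basis sX.
  have slh := moves_open bB charts (homog X hX).
  apply: (connected_link_strongly_homogeneous charts slh) => //.
  apply: contrapT => ncY; apply: nX.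
  apply: (disconnected_link_one_manifold charts (homog X hX)) => //.
  exact: basis_second_countable bB.
move=> hX lX A B.
have [[x _]|eX] := pselect (exists x : X, True); last first.
  move=> _ _ _ _; exists id; split; first exact: (auto_homeomorphism (auto_id X)).
  by apply/seteqP; split => x; exfalso; apply: eX; exists x.
have [Y charts] := locally_conical_charts x hX lX.
have [b bB] := separable_basis sX.
apply: mobile_countable_dense_homogeneous; first exact: charts_locally_compact charts.
exact (moves_open bB charts (homog X hX)).
Qed.
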